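(* Let $m=rn$. The Robinson–Schensted–Knuth correspondence $F\mapsto (P(\sigma_F),Q(\sigma_F))$ is a bijection between $\overline G_r(U,V;d)$ and the set of ordered pairs $(P,Q)$ of standard Young tableaux of equal shape, both belonging to $T([m];d)$ and both satisfying Condition (T): for each $i\in[n]$ and $1\le s<r$, the row containing $r(i-1)+s$ is strictly above the row containing $r(i-1)+s+1$. In particular $g(n;d)$ equals the number of such pairs.
   Context: Fix integers $n,r\ge1$, $m=rn$. $U=\{u_1\prec\cdots\prec u_n\}$, $V=\{v_1\prec\cdots\prec v_n\}$ are disjoint totally ordered sets. An $r$-regular bipartite multigraph on $(U,V)$ is a multiset of edges $uv$ in which every vertex has degree $r$. Edges $uv,u'v'$ are noncrossing if ($u\prec u'$ and $v\prec v'$) or ($u'\prec u$ and $v'\prec v$); a planar matching is a set of pairwise noncrossing edges; $L(G)$ is the maximum size of a planar matching of $G$; $G_r(U,V;d)$ is the set of $r$-regular bipartite multigraphs $G$ on $(U,V)$ with $L(G)\le d$ and $g(n;d)=|G_r(U,V;d)|$. Let $\overline U=U\times[r]$, $\overline V=V\times[r]$, writing $u^s$ for $(u,s)$, ordered lexicographically ($u_i^s\preceq u_j^t$ iff $i<j$, or $i=j$ and $s\le t$; same for $\overline V$), and identified with $[m]$ via $u_i^s\mapsto r(i-1)+s$, $v_i^s\mapsto r(i-1)+s$. An $r$-configuration is a bijection (perfect matching) between $\overline U$ and $\overline V$; it corresponds to the permutation $\sigma_F$ of $[m]$ with $\sigma_F(x)=y$ iff the $x$-th element of $\overline U$ is paired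 with the $y$-th element of $\overline V$. For $G$ an $r$-regular multigraph, its associated configuration $\overline G$ is defined as follows: for each edge $uv$ of $G$ of multiplicity $t\ge1$, let $i$ be the number of edges $uv'$ of $G$ (with multiplicity) with $v\prec v'$ and $j$ the number of edges $u'v$ of $G$ with $u\prec u'$; then $\overline G$ contains the pairs $(u^{i+s},v^{j+t-s+1})$ for $s=1,\dots,t$. $\overline G_r(U,V;d)=\{\overline G: G\in G_r(U,V;d)\}$, and $|\overline G_r(U,V;d)|=g(n;d)$. $T([m];d)$ is the set of standard Young tableaux with entries exactly $1,\dots,m$ and at most $d$ columns (row $i$ is above row $i+1$). For a permutation $\sigma$ of $[m]$, $P(\sigma)$ is the tableau obtained by successively row-inserting (RSK) $\sigma(1),\dots,\sigma(m)$ into the empty tableau, and $Q(\sigma)$ is the recording tableau, having entry $i$ in the box created at the $i$-th insertion. *)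

(* Defs.v *)
From mathcomp Require Import all_boot all_fingroup.
Set Implicit Arguments. Unset Strict Implicit. Unset Printing Implicit Defensive.

(* r-regular bipartite multigraphs on U = {u_1<...<u_n}, V = {v_1<...<v_n} *)
(* Vertex u_{a+1} is represented by a : 'I_n (0-based), likewise for V.    *)
(* A multigraph is its multiplicity function; multiplicities are bounded   *)
(* by r, which is automatic for r-regular multigraphs.                     *)
Definition mgraph (n r : nat) := {ffun 'I_n * 'I_n -> 'I_r.+1}.

Definition mult n r (G : mgraph n r) (a b : 'I_n) : nat := val (G (a, b)).

Definition regular n r (G : mgraph n r) : bool :=
  [forall a : 'I_n, \sum_(b : 'I_n) mult G a b == r] &&
  [forall b : 'I_n, \sum_(a : 'I_n) mult G a b == r].

Definition noncrossing n (e f : 'I_n * 'I_n) : bool :=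
  ((e.1 < f.1) && (e.2 < f.2)) || ((f.1 < e.1) && (f.2 < e.2)).

Definition planar_matching n r (G : mgraph n r) (S : {set 'I_n * 'I_n}) : bool :=
  [forall e in S, 0 < mult G e.1 e.2] &&
  [forall e in S, forall f in S, (e != f) ==> noncrossing e f].

Definition Lmax n r (G : mgraph n r) : nat :=
  \max_(S : {set 'I_n * 'I_n} | planar_matching G S) #|S|.

Definition Gset n r d : {set mgraph n r} :=
  [set G : mgraph n r | regular G && (Lmax G <= d)].
Definition gcount n r d : nat := #|Gset n r d|.

(* Associated configuration \overline G, as the list of pairs (x, y) of    *)
(* [m] (1-based, via u_i^s |-> r(i-1)+s, v_i^s |-> r(i-1)+s).             *)
Definition conf_pairs n r (G : mgraph n r) : seq (nat * nat) :=
  flatten [seq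
    let a := e.1 in let b := e.2 in
    let t := mult G a b in
    let i := \sum_(b' : 'I_n | b < b') mult G a b' in
    let j := \sum_(a' : 'I_n | a < a') mult G a' b in
    [seq (r * a + (i + s), r * b + (j + t - s + 1)) | s <- iota 1 t]
  | e <- enum [set: 'I_n * 'I_n]].

(* The permutation sigma of [m] = {1..m} is represented by a permutation   *)
(* of 'I_m shifted by one: sigma(x+1) = (s x)+1.  s is the configuration  *)
(* of G iff it contains all pairs of \overline G.                          *)
Definition is_conf_of n r (G : mgraph n r) (s : {perm 'I_(r * n)}) : Prop :=
  forall p, p \in conf_pairs G ->
    exists x : 'I_(r * n), x.+1 = p.1 /\ (s x).+1 = p.2.

Definition in_Gbar n r d (s : {perm 'I_(r * n)}) : Prop :=
  exists G : mgraph n r, G \in Gset n r d /\ is_conf_of G s.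

(* Young tableaux: list of rows, row 0 on top.                            *)
Definition tableau := seq (seq nat).

Definition entry (t : tableau) (i j : nat) : nat := nth 0 (nth [::] t i) j.

Definition is_shape_ok (t : tableau) : bool :=
  all (fun row => 0 < size row) t &&
  sorted geq (map size t).

Definition rows_incr (t : tableau) : bool := all (sorted ltn) t.

Definition cols_incr (t : tableau) : bool :=
  [forall i : 'I_(size t), forall j : 'I_(size (nth [::] t i.+1)),
     entry t i j < entry t i.+1 j].

Definition SYT (m : nat) (t : tableau) : bool :=
  [&& is_shape_ok t, rows_incr t, cols_incr t & perm_eq (flatten t) (iota 1 m)].

Definition ncols (t : tableau) : nat := size (head [::] t).

Definition in_T (m d : nat) (t : tableau) : bool := SYT m t && (ncols t <= d).

Definition shape (t : tableau) : seq nat := map size t.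

Definition row_of (t : tableau) (x : nat) : nat := find (fun row => x \in row) t.

Definition condT (n r : nat) (t : tableau) : Prop :=
  forall i s, 1 <= i <= n -> 1 <= s < r ->
    row_of t (r * (i - 1) + s) < row_of t (r * (i - 1) + s + 1).

Fixpoint rinsert (t : tableau) (x : nat) : tableau * nat :=
  match t with
  | [::] => ([:: [:: x]], 0)
  | row :: t' =>
      if has (fun y => x < y) row then
        let k := find (fun y => x < y) row in
        let y := nth 0 row k in
        let (t'', i) := rinsert t' y in
        (set_nth 0 row k x :: t'', i.+1)
      else (rcons row x :: t', 0)
  end.

(* add a box with entry k at the end of row i (i <= size Q) *)
Definition addbox (Q : tableau) (i k : nat) : tableau :=
  if i < size Q then set_nth [::] Q i (rcons (nth [::] Q i) k)
  else rcons Q [:: k].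

Fixpoint rsk_rec (w : seq nat) (P Q : tableau) (k : nat) : tableau * tableau :=
  match w with
  | [::] => (P, Q)
  | x :: w' =>
      let (P', i) := rinsert P x in
      rsk_rec w' P' (addbox Q i k) k.+1
  end.

Definition RSK (w : seq nat) : tableau * tableau := rsk_rec w [::] [::] 1.

Definition perm_word m (s : {perm 'I_m}) : seq nat :=
  [seq (s x).+1 | x <- enum 'I_m].

Definition good_pair (n r d : nat) (PQ : tableau * tableau) : Prop :=
  [/\ shape PQ.1 = shape PQ.2,
      in_T (r * n) d PQ.1, in_T (r * n) d PQ.2,
      condT n r PQ.1 & condT n r PQ.2].

(* Main.v *)
Require Import Defs.
From mathcomp Require Import all_boot all_fingroup.
From mathcomp Require Import zify.

Set Implicit Arguments. Unset Strict Implicit. Unset Printing Implicit Defensive.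

(** A permutation is the configuration of some regular multigraph exactly when
    it and its inverse are decreasing on every block [r(i-1)+1, ..., ri]; the
    multigraph is then recovered by contracting the blocks, and its planar
    matchings correspond to the increasing subsequences of the permutation.
    Under RSK, a descent at [k] of the permutation says that [k+1] lies strictly
    below [k] in [Q], a descent of the inverse says the same about [P], and by
    Schensted's theorem the longest increasing subsequence has length the
    number of columns. *)

(** * Row insertion *)

(** The configuration is arranged so that two pairs meeting a common block of [U] or of [V] never
    form an increasing pair: later neighbours take the smaller copies, and parallel edges are
    matched in reverse order. An increasing subsequence therefore meets each block at most once, and
    this is what makes it project to a planar matching.

    Bijectivity of RSK is proved by peeling off the last letter. The largest entry of [Q] names the
    row in which the last insertion ended, and from there the insertion is undone upwards. What
    remains of [P] no longer has the entries [1..m], so the tableau predicate has to admit arbitrary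
    distinct entries.

    Descents of the inverse are not obtained from the symmetry that exchanges [P] and [Q]. Instead,
    the relative order of [k] and [k+1] in the word survives in the row reading word of [P], where
    it tells which of the two lies in the lower row. Schensted's theorem comes from the patience
    sorting invariant of the first row. *)

Definition bump_index (r : seq nat) (x : nat) := find (fun y => x < y) r.

Definition bumped (r : seq nat) (x : nat) := nth 0 r (bump_index r x).

(* When no entry exceeds [x], the index is [size r] and [set_nth] appends. *)
Definition row_insert (r : seq nat) (x : nat) := set_nth 0 r (bump_index r x) x.

Definition above (r1 r2 : seq nat) : bool :=
  (size r2 <= size r1) &&
  all (fun j => nth 0 r1 j < nth 0 r2 j) (iota 0 (size r2)).

(** The conditions are attached row by row so that inductions along a bumping route can peel off the
    top row. The default [[::]] makes the bottom row lie above an empty one. Entries are not tied to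
    [1..m], because rows below the first receive arbitrary bumped values. *)
Fixpoint is_tab (t : tableau) : bool :=
  if t is r :: t' then
    [&& 0 < size r, sorted ltn r, above r (head [::] t') & is_tab t']
  else true.

Lemma is_tab_consP r t :
  reflect [/\ 0 < size r, sorted ltn r, above r (head [::] t) & is_tab t]
          (is_tab (r :: t)).
Proof. exact: and4P. Qed.

Lemma aboveP r1 r2 :
  reflect (size r2 <= size r1 /\
           forall j, j < size r2 -> nth 0 r1 j < nth 0 r2 j)
          (above r1 r2).
Proof.
apply: (iffP andP) => -[le_sz H]; split=> //.
  by move=> j ltj; apply: (allP H); rewrite mem_iota.
by apply/allP=> j; rewrite mem_iota => /andP[_ ltj]; apply: H.
Qed.

Lemma sorted_ltnP (r : seq nat) :
  reflect (forall i j, i < j -> j < size r -> nth 0 r i < nth 0 r j)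
          (sorted ltn r).
Proof.
apply: (iffP idP) => [H i j ltij ltj | H].
  by apply: (sorted_ltn_nth ltn_trans) => //; rewrite inE; lia.
by apply/(sortedP 0) => i lti; apply: H.
Qed.

Lemma bump_index_size r x : bump_index r x <= size r.
Proof. exact: find_size. Qed.

Lemma before_bump r x j : j < bump_index r x -> nth 0 r j <= x.
Proof. by move/(before_find 0)/negbT; rewrite -leqNgt. Qed.

Lemma before_bump_lt r x j :
  x \notin r -> j < bump_index r x -> nth 0 r j < x.
Proof.
move=> xr ltj; rewrite ltn_neqAle before_bump // andbT.
apply: contra xr => /eqP <-; apply: mem_nth.
exact: leq_trans ltj (bump_index_size _ _).
Qed.

Lemma bump_at r x : bump_index r x < size r -> x < bumped r x.
Proof. by rewrite -has_find => H; exact: (nth_find 0 H). Qed.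

Lemma after_bump r x j :
  sorted ltn r -> bump_index r x <= j -> j < size r -> x < nth 0 r j.
Proof.
move=> /sorted_ltnP sr lej ltj.
have lt := bump_at (leq_ltn_trans lej ltj).
case: (ltngtP (bump_index r x) j) lej => // [ltij|<- //] _.
exact: ltn_trans lt (sr _ _ ltij ltj).
Qed.

Lemma bump_index_uniq r x k :
  k <= size r -> (forall j, j < k -> nth 0 r j <= x) ->
  (k < size r -> x < nth 0 r k) -> bump_index r x = k.
Proof.
move=> lek Hlt Hge; apply/eqP; rewrite eqn_leq; apply/andP; split.
  rewrite leqNgt; apply/negP => ltk.
  have := before_bump ltk; have := bump_index_size r x; lia.
rewrite leqNgt; apply/negP => ltk.
have := Hlt _ ltk; have := @bump_at r x; rewrite /bumped; lia.
Qed.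

Lemma size_row_insert r x :
  size (row_insert r x) = maxn (bump_index r x).+1 (size r).
Proof. exact: size_set_nth. Qed.

Lemma nth_row_insert r x j :
  nth 0 (row_insert r x) j = if j == bump_index r x then x else nth 0 r j.
Proof. by rewrite nth_set_nth /=. Qed.

Lemma sorted_row_insert r x :
  sorted ltn r -> x \notin r -> sorted ltn (row_insert r x).
Proof.
move=> sr xr; apply/sorted_ltnP => i j ltij.
rewrite size_row_insert !nth_row_insert => ltj.
have lek := bump_index_size r x.
case: (eqVneq i) => [ei|nei]; case: (eqVneq j) => [ej|nej]; first by lia.
- by apply: after_bump => //; lia.
- by apply: before_bump_lt => //; lia.
- by apply: (sorted_ltnP _ sr) => //; lia.
Qed.

Lemma row_insert_split r x : bump_index r x < size r ->
  r = take (bump_index r x) r ++ bumped r x :: drop (bump_index r x).+1 r /\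
  row_insert r x = take (bump_index r x) r ++ x :: drop (bump_index r x).+1 r.
Proof.
move=> ltk; split; last by rewrite /row_insert set_nthE ltk.
by rewrite /bumped -drop_nth // cat_take_drop.
Qed.

Lemma row_insert_rcons r x :
  bump_index r x = size r -> row_insert r x = rcons r x.
Proof. by move=> E; rewrite /row_insert E set_nthE ltnn subnn cats1. Qed.

Lemma perm_row_insert r x : bump_index r x < size r ->
  perm_eq (bumped r x :: row_insert r x) (x :: r).
Proof.
move=> ltk; have [E1 E2] := row_insert_split ltk.
rewrite E2 [in X in perm_eq _ X]E1.
apply/seq.permP => p /=; rewrite !count_cat /=; lia.
Qed.

Lemma rinsert_cons r t x :
  rinsert (r :: t) x =
    if bump_index r x < size r then
      (row_insert r x :: (rinsert t (bumped r x)).1,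
       (rinsert t (bumped r x)).2.+1)
    else (row_insert r x :: t, 0).
Proof.
rewrite /= has_find; case: ltnP => [lt|ge].
  by rewrite -/(bump_index r x) -/(bumped r x); case: (rinsert t (bumped r x)).
by rewrite row_insert_rcons //; apply/eqP; rewrite eqn_leq bump_index_size.
Qed.

Lemma head_rinsert t x :
  head [::] (rinsert t x).1 = row_insert (head [::] t) x.
Proof. by case: t => // r t; rewrite rinsert_cons; case: ifP. Qed.

(** The bumped entry moves weakly to the left: in its own column the entry below it is already
    larger. Only the columns [k] and [k2] change, and there [x < y] and the order inside [r1]
    suffice. *)
Lemma above_row_insert r1 r2 x :
  sorted ltn r1 -> bump_index r1 x < size r1 -> above r1 r2 ->
  above (row_insert r1 x) (row_insert r2 (bumped r1 x)).
Proof.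
move=> /sorted_ltnP s1 ltk /aboveP[le_sz ab].
set y := bumped r1 x; set k := bump_index r1 x; set k2 := bump_index r2 y.
have lek2 : k2 <= k.
  rewrite leqNgt; apply/negP => ltk2.
  have yE : y = nth 0 r1 k by [].
  have := before_bump ltk2; have := ab k; have := bump_index_size r2 y.
  by rewrite -/k2; lia.
have lty := bump_at ltk; rewrite -/y in lty.
have lek2s := bump_index_size r2 y; rewrite -/k2 in lek2s.
apply/aboveP; rewrite !size_row_insert -/k -/k2; split; first lia.
move=> j ltj; rewrite !nth_row_insert -/k -/k2.
case: (eqVneq j k) => [ejk|nek]; [rewrite ejk in ltj *|];
  case: (eqVneq _ k2) => [e2|ne2] //.
- by apply: (ltn_trans lty); apply: ab; lia.
- by apply: s1; lia.
- by apply: ab; lia.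
Qed.

Lemma above_rcons r1 r2 x : above r1 r2 -> above (rcons r1 x) r2.
Proof.
move=> /aboveP[le_sz ab]; apply/aboveP; rewrite size_rcons; split; first lia.
by move=> j ltj; rewrite nth_rcons (leq_trans ltj le_sz) ab.
Qed.

Lemma bumped_mem r x : bump_index r x < size r -> bumped r x \in r.
Proof. exact: mem_nth. Qed.

Lemma perm_rinsert t x : perm_eq (flatten (rinsert t x).1) (x :: flatten t).
Proof.
elim: t x => [|r t IH] x //; rewrite rinsert_cons; case: ltnP => [lt|ge] /=.
  have H1 := IH (bumped r x); have H2 := perm_row_insert lt.
  apply/seq.permP => p; move/seq.permP/(_ p): H1; move/seq.permP/(_ p): H2.
  rewrite /= !count_cat /=; lia.
rewrite row_insert_rcons; last by apply/eqP; rewrite eqn_leq bump_index_size.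
by apply/seq.permP => p; rewrite /= !count_cat -cats1 count_cat /=; lia.
Qed.

Lemma is_tab_rinsert t x :
  is_tab t -> uniq (x :: flatten t) -> is_tab (rinsert t x).1.
Proof.
elim: t x => [|r t IH] x // /is_tab_consP[r0 sr ab tt].
rewrite [flatten _]/= cons_uniq mem_cat negb_or cat_uniq.
move=> /andP[/andP[xr xt] /and3P[ur disj ut]].
have size0 : 0 < size (row_insert r x) by rewrite size_row_insert; lia.
rewrite rinsert_cons; case: ltnP => [lt|ge] /=; rewrite size0 sorted_row_insert //=.
  rewrite head_rinsert above_row_insert //=; apply: IH => //.
  rewrite cons_uniq ut andbT; apply: contra disj => H.
  by apply/hasP; exists (bumped r x) => //; apply: bumped_mem.
rewrite row_insert_rcons; last by apply/eqP; rewrite eqn_leq bump_index_size.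
by rewrite above_rcons.
Qed.

Lemma addbox_nil i k : addbox [::] i k = [:: [:: k]].
Proof. by []. Qed.

Lemma addbox_cons0 r t k : addbox (r :: t) 0 k = rcons r k :: t.
Proof. by []. Qed.

Lemma addbox_consS r t i k : addbox (r :: t) i.+1 k = r :: addbox t i k.
Proof. by rewrite /addbox /= ltnS; case: ifP. Qed.

Definition addboxE := (addbox_nil, addbox_cons0, addbox_consS).

Lemma shape_rinsert t x k :
  shape (rinsert t x).1 = shape (addbox t (rinsert t x).2 k).
Proof.
elim: t x => [|r t IH] x //; rewrite rinsert_cons; case: ltnP => [lt|ge].
  rewrite addboxE /shape /= -/(shape _) IH size_row_insert; congr (_ :: _); lia.
by rewrite addboxE /= size_row_insert size_rcons; congr (_ :: _);
   have := bump_index_size r x; lia.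
Qed.

Lemma rinsert_row_size t x : (rinsert t x).2 <= size t.
Proof.
by elim: t x => [|r t IH] x //; rewrite rinsert_cons; case: ltnP => //= _; apply: IH.
Qed.

Lemma shape_addbox t1 t2 i k1 k2 :
  shape t1 = shape t2 -> shape (addbox t1 i k1) = shape (addbox t2 i k2).
Proof.
elim: t1 t2 i => [|r1 t1 IH] [|r2 t2] [|i] // [e1 e2]; rewrite !addboxE /=.
  by rewrite /shape /= !size_rcons e1; congr (_ :: _).
by rewrite /shape /= e1; congr (_ :: _); apply: IH.
Qed.

Lemma perm_addbox t i k : perm_eq (flatten (addbox t i k)) (k :: flatten t).
Proof.
elim: t i => [|r t IH] [|i]; rewrite ?addboxE //=.
  by apply/seq.permP => p; rewrite /= !count_cat -cats1 count_cat /=; lia.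
have /seq.permP H := IH i; apply/seq.permP => p; have := H p.
by rewrite /= !count_cat /=; lia.
Qed.

(* The inserted entry is the largest one below the bumped entry, so the bumping
   position can be read off the result. *)
Lemma bump_index_inv r x : sorted ltn r -> x \notin r ->
  bump_index r x < size r ->
  forall j, j < size r ->
    (nth 0 (row_insert r x) j < bumped r x) = (j <= bump_index r x).
Proof.
move=> sr xr lt j ltj; rewrite nth_row_insert.
case: eqVneq => [->|ne]; first by rewrite bump_at // leqnn.
have s := sorted_ltnP _ sr; rewrite /bumped.
case: (ltngtP j (bump_index r x)) ne => // [l|g] _; first exact: s.
by apply/negbTE; rewrite -leqNgt; apply: ltnW; apply: s.
Qed.

Lemma row_insert_inj r1 r2 x1 x2 :
  sorted ltn r1 -> sorted ltn r2 -> x1 \notin r1 -> x2 \notin r2 ->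
  bump_index r1 x1 < size r1 -> bump_index r2 x2 < size r2 ->
  row_insert r1 x1 = row_insert r2 x2 -> bumped r1 x1 = bumped r2 x2 ->
  r1 = r2 /\ x1 = x2.
Proof.
move=> s1 s2 n1 n2 l1 l2 E B.
have Es : size r1 = size r2.
  by move/(congr1 size): E; rewrite !size_row_insert; lia.
(* By [bump_index_inv], each bumping position is the last one whose entry is below the common bumped
   value. *)
have Ek : bump_index r1 x1 = bump_index r2 x2.
  have H1 := bump_index_inv s1 n1 l1; have H2 := bump_index_inv s2 n2 l2.
  have := H1 (bump_index r2 x2); have := H2 (bump_index r1 x1).
  have := H1 (bump_index r1 x1); have := H2 (bump_index r2 x2).
  rewrite E B Es !leqnn; lia.
have N j : nth 0 (row_insert r1 x1) j = nth 0 (row_insert r2 x2) j by rewrite E.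
split; last by have := N (bump_index r1 x1); rewrite !nth_row_insert Ek eqxx.
apply: (@eq_from_nth _ 0) => // j ltj; have := N j; rewrite !nth_row_insert Ek.
by case: eqVneq => // -> _; move: B; rewrite /bumped Ek.
Qed.

(** The row index tells what happened in the top row: [0] means that the last entry was appended, a
    successor means that an entry was bumped, and the latter is recovered from the lower rows by
    induction. An empty and a non-empty tableau cannot collide, since appending to a non-empty row
    gives length at least two. *)
Lemma rinsert_inj t1 t2 x1 x2 :
  is_tab t1 -> is_tab t2 -> uniq (x1 :: flatten t1) -> uniq (x2 :: flatten t2) ->
  rinsert t1 x1 = rinsert t2 x2 -> t1 = t2 /\ x1 = x2.
Proof.
elim: t1 t2 x1 x2 => [|r1 t1 IH] [|r2 t2] x1 x2.
- by move=> _ _ _ _ [->].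
- move=> _ /is_tab_consP[r0 _ _ _] _ _; rewrite rinsert_cons; case: ltnP => // ge [E _].
  by move/(congr1 size): E; rewrite size_row_insert /=; lia.
- move=> /is_tab_consP[r0 _ _ _] _ _ _; rewrite rinsert_cons; case: ltnP => // ge [E _].
  by move/(congr1 size): E; rewrite size_row_insert /=; lia.
move=> /is_tab_consP[_ s1 _ tt1] /is_tab_consP[_ s2 _ tt2].
rewrite /= !mem_cat !negb_or !cat_uniq.
move=> /andP[/andP[n1 _] /and3P[_ d1 u1]] /andP[/andP[n2 _] /and3P[_ d2 u2]].
rewrite -!/(rinsert (_ :: _) _) !rinsert_cons; case: ltnP => l1; case: ltnP => l2 // [].
  move=> E Et Ei.
  have u1' : uniq (bumped r1 x1 :: flatten t1).
    rewrite cons_uniq u1 andbT; apply: contra d1 => H.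
    by apply/hasP; exists (bumped r1 x1) => //; apply: bumped_mem.
  have u2' : uniq (bumped r2 x2 :: flatten t2).
    rewrite cons_uniq u2 andbT; apply: contra d2 => H.
    by apply/hasP; exists (bumped r2 x2) => //; apply: bumped_mem.
  have [|-> Ey] := IH t2 (bumped r1 x1) (bumped r2 x2) tt1 tt2 u1' u2'.
    by rewrite [LHS]surjective_pairing [RHS]surjective_pairing Et Ei.
  by have [-> ->] := row_insert_inj s1 s2 n1 n2 l1 l2 E Ey.
rewrite !row_insert_rcons; try by apply/eqP; rewrite eqn_leq bump_index_size.
by move=> /rcons_inj[-> ->] ->.
Qed.

(** * Bumping routes of two successive insertions *)

Lemma bump_index_row_insert_gt r x x' :
  x < x' -> bump_index r x < bump_index (row_insert r x) x'.
Proof.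
move=> lt; rewrite ltnNge; apply/negP => le.
have : bump_index (row_insert r x) x' < size (row_insert r x).
  by rewrite size_row_insert; lia.
move/bump_at; rewrite /bumped nth_row_insert; case: eqVneq => [_|ne]; first by lia.
have := @before_bump r x (bump_index (row_insert r x) x'); lia.
Qed.

Lemma bump_index_row_insert_lt r x x' :
  x' < x -> bump_index (row_insert r x) x' <= bump_index r x.
Proof.
move=> lt; rewrite leqNgt; apply/negP => /before_bump.
by rewrite nth_row_insert eqxx; lia.
Qed.

(** In each row the second route passes strictly to the right of the first, so the entries handed
    down are again in increasing order. Where the first route ends by appending, the second can only
    append as well. *)
Lemma row_bumping_weak t x x' : is_tab t -> x < x' ->
  (rinsert (rinsert t x).1 x').2 <= (rinsert t x).2.
Proof.
elim: t x x' => [|r t IH] x x' tt lt.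
  by rewrite /= orbF ltnNge (ltnW lt).
have /is_tab_consP[_ /sorted_ltnP sr _ {}tt] := tt.
have ltk := @bump_index_row_insert_gt r _ _ lt.
rewrite rinsert_cons; case: (ltnP (bump_index r x)) => [l1|g1].
  rewrite rinsert_cons; case: ltnP => [l2|//] /=; rewrite ltnS; apply: IH => //.
  rewrite /bumped nth_row_insert gtn_eqF //; apply: sr => //.
  by move: l2; rewrite size_row_insert; lia.
rewrite rinsert_cons; case: ltnP => //.
rewrite size_row_insert; have := bump_index_size r x; lia.
Qed.

(** Here the second route stays weakly to the left of the first. It therefore always meets an entry
    to bump, even in the row where the first route ended, and the entries handed down are again in
    decreasing order. *)
Lemma row_bumping_strict t x x' : is_tab t -> x' < x ->
  (rinsert t x).2 < (rinsert (rinsert t x).1 x').2.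
Proof.
elim: t x x' => [|r t IH] x x' tt lt; first by rewrite /= lt.
have /is_tab_consP[_ sr _ {}tt] := tt.
have ltk := @bump_index_row_insert_lt r _ _ lt.
have l2 : bump_index (row_insert r x) x' < size (row_insert r x).
  by rewrite size_row_insert; lia.
rewrite rinsert_cons; case: (ltnP (bump_index r x)) => [l1|g1];
  rewrite rinsert_cons l2 //= ltnS; apply: IH => //.
have lx := bump_at l1; apply: leq_ltn_trans lx.
rewrite {1}/bumped nth_row_insert; case: eqVneq => // ne.
by apply: before_bump; lia.
Qed.

(** * Row reading word and the order of consecutive values *)

Definition reading (t : tableau) : seq nat := flatten (rev t).

Lemma reading_cons r t : reading (r :: t) = reading t ++ r.
Proof. by rewrite /reading rev_cons -cats1 flatten_cat /= cats0. Qed.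

Lemma perm_reading t : perm_eq (reading t) (flatten t).
Proof.
elim: t => [//|r t IH]; rewrite reading_cons /= perm_catC perm_cat2l.
exact: IH.
Qed.

Lemma mem_reading t : reading t =i flatten t.
Proof. exact: perm_mem (perm_reading t). Qed.

(* The two words are Knuth equivalent, and an elementary Knuth transformation
   never exchanges two consecutive integers. *)
Lemma filter_row_insert k r x :
  sorted ltn r -> x \notin r -> bump_index r x < size r ->
  filter (pred2 k k.+1) (bumped r x :: row_insert r x) =
  filter (pred2 k k.+1) (rcons r x).
Proof.
move=> sr xr lt; have [E1 E2] := row_insert_split lt.
have lty := bump_at lt; set f := pred2 k k.+1.
set y := bumped r x in E1 lty *; set r1 := take _ r in E1 E2.
set r2 := drop _ r in E1 E2.
have -> : y :: row_insert r x = [:: y] ++ r1 ++ [:: x] ++ r2 by rewrite E2.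
have -> : rcons r x = r1 ++ [:: y] ++ r2 ++ [:: x].
  by rewrite {1}E1 -cats1 -catA.
rewrite !filter_cat.
(* The two words differ by moving [y] across [r1] and [x] across [r2]. Entries of [r1] are below
   [x < y], hence at most [y - 2]; entries of [r2] exceed [y > x], hence are at least [x + 2].
   Neither move exchanges [k] and [k+1]. *)
have H1 : f y -> filter f r1 = [::].
  move=> fy; apply/eqP; rewrite -size_eq0 size_filter -leqn0 leqNgt -has_count.
  apply/hasPn => z /(nthP 0)[j]; rewrite size_take lt => ltj <-.
  rewrite nth_take //; have := before_bump_lt xr ltj.
  by move: fy; rewrite /f /=; lia.
have H2 : f x -> filter f r2 = [::].
  move=> fx; apply/eqP; rewrite -size_eq0 size_filter -leqn0 leqNgt -has_count.
  apply/hasPn => z /(nthP 0)[j]; rewrite size_drop ltn_subRL => ltj <-.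
  rewrite nth_drop.
  have : y < nth 0 r ((bump_index r x).+1 + j).
    by apply: (sorted_ltnP _ sr (bump_index r x)) => //; lia.
  by move: fx lty; rewrite /f /=; lia.
rewrite [filter f [:: y]]/= [filter f [:: x]]/=.
case: ifP => [/H1 -> |_]; case: ifP => [/H2 -> | _] //=; rewrite ?cats0 //.
Qed.

Lemma filter_reading_rinsert k t x :
  is_tab t -> uniq (x :: flatten t) ->
  filter (pred2 k k.+1) (reading (rinsert t x).1) =
  filter (pred2 k k.+1) (rcons (reading t) x).
Proof.
elim: t x => [//|r t IH] x /is_tab_consP[_ sr _ tt].
rewrite [flatten _]/= cons_uniq mem_cat negb_or cat_uniq.
move=> /andP[/andP[xr xt] /and3P[ur disj ut]].
rewrite rinsert_cons; case: ltnP => [lt|ge]; rewrite !reading_cons /=.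
  rewrite filter_cat IH //; last first.
    rewrite cons_uniq ut andbT; apply: contra disj => H.
    by apply/hasP; exists (bumped r x) => //; apply: bumped_mem.
  by rewrite -filter_cat cat_rcons filter_cat filter_row_insert // -filter_cat rcons_cat.
rewrite row_insert_rcons ?rcons_cat //.
by apply/eqP; rewrite eqn_leq bump_index_size.
Qed.

(** * Patience sorting and increasing subsequences *)

Lemma subseq_rcons_rcons (T : eqType) (u w : seq T) (y x : T) :
  subseq (rcons u y) (rcons w x) =
  subseq (if y == x then u else rcons u y) w.
Proof.
rewrite -subseq_rev !rev_rcons /= -[RHS]subseq_rev.
by case: eqP; rewrite ?rev_rcons.
Qed.

Lemma sorted_rcons (u : seq nat) x :
  sorted ltn (rcons u x) = sorted ltn u && ((u == [::]) || (last 0 u < x)).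
Proof. by case: u => //= a u; rewrite rcons_path. Qed.

(** Schensted's invariant: the two clauses together make entry [j] of [r] the least possible last
    entry of an increasing subsequence of [w] of length [j+1], so [size r] is the maximal length. *)
Definition patience (w r : seq nat) : Prop :=
  (forall j, j < size r -> exists u : seq nat,
     [/\ subseq u w, sorted ltn u, size u = j.+1 & last 0 u = nth 0 r j]) /\
  (forall u : seq nat, subseq u w -> sorted ltn u -> 0 < size u ->
     size u <= size r /\ nth 0 r (size u).-1 <= last 0 u).

Lemma patience_row_insert w r x :
  sorted ltn r -> x \notin r -> patience w r ->
  patience (rcons w x) (row_insert r x).
Proof.
move=> sr xr [Hex Hmin]; split.
  move=> j; rewrite size_row_insert nth_row_insert => ltj.
  case: eqVneq => [ej|nej].
    case: (posnP j) => [j0|j0].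
      exists [:: x]; split=> //; last by rewrite j0.
      by rewrite sub1seq mem_rcons mem_head.
    have [|u [su ou zu lu]] := Hex j.-1; first by have := bump_index_size r x; lia.
    (* The entry just left of the bumping position is below [x], so a subsequence ending there can
       be prolonged by [x]. *)
    exists (rcons u x); rewrite subseq_rcons_rcons eqxx sorted_rcons ou size_rcons.
    rewrite last_rcons zu lu before_bump_lt ?orbT //; last lia.
    by split=> //; lia.
  have [|u [su ou zu lu]] := Hex j; first by have := bump_index_size r x; lia.
  exists u; split=> //; exact: subseq_trans su (subseq_rcons _ _).
case/lastP => [//|u y]; rewrite subseq_rcons_rcons sorted_rcons size_rcons last_rcons.
rewrite size_row_insert nth_row_insert /=.
case: (eqVneq y x) => [->|ne] su /andP[ou lu] _.
  case: (posnP (size u)) => [/size0nil -> /=|u0].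
    split; first by lia.
    case: eqVneq => // ne; apply: before_bump; lia.
  have [zu mu] := Hmin u su ou u0.
  have lux : last 0 u < x by case: (u) u0 lu.
  (* By minimality, entry [size u - 1] of the old row is at most the last entry of [u], which is
     below [x]; it therefore precedes the bumping position. *)
  have : size u <= bump_index r x.
    rewrite leqNgt; apply/negP => lt.
    have := @after_bump r x (size u).-1 sr; lia.
  move=> le; split; first by lia.
  case: eqVneq => // ne; apply: before_bump; lia.
(* A subsequence that does not end in the new [x] lies in [w], and the insertion only lowers entries
   of the row. *)
have [|||] := Hmin (rcons u y); rewrite ?sorted_rcons ?ou ?size_rcons // last_rcons /=.
move=> zu mu; split; first by lia.
case: eqVneq => // e; have := @after_bump r x (size u) sr; lia.
Qed.

(** * Undoing a recording step and an insertion *)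

Lemma head_addbox t i k : i <= size t ->
  head [::] (addbox t i k) =
  if i == 0 then rcons (head [::] t) k else head [::] t.
Proof. by case: t => [|r t]; case: i => [|i]; rewrite ?addboxE. Qed.

(** A new largest entry cannot break the order in rows or columns; the danger is a row growing
    longer than the one above it. The tableau [P] of the same shape rules this out. *)
Lemma is_tab_addbox Q P i k :
  is_tab Q -> i <= size Q -> all (fun x => x < k) (flatten Q) ->
  is_tab P -> shape P = shape (addbox Q i k) -> is_tab (addbox Q i k).
Proof.
elim: Q P i => [|r t IH] P [|i] //.
  move=> /is_tab_consP[r0 sr ab tt] _; rewrite addboxE /= all_cat => /andP[ltk _] _ _.
  rewrite size_rcons above_rcons // tt sorted_rcons sr andbT /=.
  case: r r0 ltk {sr ab} => // a r _ ltk /=; rewrite andbT.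
  exact: (allP ltk _ (mem_last a r)).
move=> /is_tab_consP[r0 sr ab tt] le; rewrite addboxE /= all_cat => /andP[ltk ltk'].
case: P => [//|r1 P] /is_tab_consP[_ _ ab1 tP] [e1 e2]; rewrite r0 sr /=.
have tA : is_tab (addbox t i k) by apply: IH tP e2.
rewrite tA andbT; have /aboveP[le1 _] := ab1.
have eh : size (head [::] P) = size (head [::] (addbox t i k)).
  by case: (P) (addbox t i k) e2 => [|? ?] [|? ?] //= [].
rewrite eh e1 in le1; apply/aboveP; split=> // j.
have /aboveP[le2 ab2] := ab.
move: le1; rewrite head_addbox //; case: ifP => _; last by move=> _; apply: ab2.
rewrite size_rcons nth_rcons => lt; rewrite ltnS leq_eqVlt => /orP[/eqP ->|ltj].
  by rewrite ltnn eqxx; apply: (allP ltk); apply: mem_nth.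
by rewrite ltj ab2.
Qed.

(** The largest entry ends its row, and no box lies beneath it, as that box would hold something
    larger. Deleting it thus leaves a tableau. *)
Lemma is_tab_split_max Q k :
  is_tab Q -> uniq (flatten Q) -> k \in flatten Q ->
  all (fun x => x <= k) (flatten Q) ->
  exists Q0 i, [/\ is_tab Q0, i <= size Q0 & Q = addbox Q0 i k].
Proof.
elim: Q => [//|r t IH] /is_tab_consP[r0 /[dup] sr /sorted_ltnP sr' /aboveP[le_sz ab] tt].
rewrite /= mem_cat all_cat cat_uniq => /and3P[ur disj ut] kin /andP[lek lekt].
have [kr|kr] := boolP (k \in r); last first.
  rewrite (negbTE kr) in kin; have [Q0 [i [tQ le EQ]]] := IH tt ut kin lekt.
  exists (r :: Q0), i.+1; split; rewrite ?addboxE ?EQ //=.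
  rewrite r0 sr tQ andbT /=; apply/aboveP.
  move: le_sz ab; rewrite EQ head_addbox //; case: eqP => _; last by [].
  rewrite size_rcons => lt ab; split=> [|j ltj]; first lia.
  by have := ab j; rewrite nth_rcons ltj; apply; lia.
have /(nthP 0)[p ltp Ep] := kr.
case/lastP: r => [//|r x] in r0 sr sr' le_sz ab lek kr disj ur ltp Ep {kin} *.
rewrite size_rcons in le_sz ltp sr'.
have Ex : x = k.
  have := sr' p (size r); rewrite Ep nth_rcons ltnn eqxx => H.
  have : x <= k by apply: (allP lek); rewrite mem_rcons mem_head.
  case: (ltngtP p (size r)) => [l||e]; [|lia|].
    by have := H l (ltnSn _); lia.
  by move: Ep; rewrite e nth_rcons ltnn eqxx.
move: sr; rewrite sorted_rcons => /andP[sr _].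
have le_sz' : size (head [::] t) <= size r.
  rewrite leqNgt; apply/negP => lt.
  have := ab _ lt; rewrite nth_rcons ltnn eqxx Ex ltnNge => /negP; apply.
  apply: (allP lekt); case: (t) lt => [//|r2 t2] /= lt.
  by rewrite mem_cat mem_nth.
(* A row consisting of [k] alone has no row below it; it disappears altogether, since a tableau has
   no empty row. *)
case: (posnP (size r)) => [rn|rpos].
  exists [::], 0; split=> //; move: le_sz' tt; rewrite (size0nil rn) Ex leqn0 => /eqP.
  by case: (t) => // r2 t2 /= ->.
exists (r :: t), 0; split; rewrite ?addboxE ?Ex //=.
rewrite rpos sr tt andbT /=; apply/aboveP; split=> // j ltj.
by have := ab j ltj; rewrite nth_rcons (leq_trans ltj le_sz').
Qed.

(** On its way back up, [y] replaces the last entry of [r1] smaller than itself, at position [K.-1].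
    Such an entry exists because the one directly above the place of [y] in the lower row is smaller
    than [y]. *)
Lemma row_unbump r1 r2 y :
  sorted ltn r1 -> sorted ltn r2 -> y \notin r1 -> above r1 (row_insert r2 y) ->
  exists r x, [/\ size r = size r1, sorted ltn r & above r r2] /\
    [/\ bump_index r x < size r, bumped r x = y & row_insert r x = r1].
Proof.
move=> s1 s2 y1 /aboveP[]; have s1' := sorted_ltnP _ s1.
set k2 := bump_index r2 y; set K := bump_index r1 y; rewrite size_row_insert => le ab.
have lt2 : k2 < K.
  rewrite ltnNge; apply/negP => leK.
  have := ab k2; have := after_bump s1 leK.
  by rewrite nth_row_insert -/k2 eqxx; lia.
have leK : K <= size r1 := bump_index_size _ _.
pose k := K.-1; pose r := set_nth 0 r1 k y; pose x := nth 0 r1 k.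
have nr j : nth 0 r j = if j == k then y else nth 0 r1 j by rewrite nth_set_nth.
have sz : size r = size r1 by rewrite size_set_nth; lia.
have ltx : x < y by apply: before_bump_lt => //; lia.
have Ek : bump_index r x = k.
  apply: bump_index_uniq; rewrite ?sz ?nr ?eqxx //; first by lia.
  by move=> j ltj; rewrite nr ltn_eqF //; apply: ltnW; apply: s1'; lia.
exists r, x; split; split=> //; rewrite ?sz ?Ek //; try lia.
- apply/sorted_ltnP => i j ltij; rewrite sz !nr => ltj.
  case: (eqVneq i) => [ei|nei]; case: (eqVneq j) => [ej|nej]; first by lia.
  + by apply: after_bump => //; lia.
  + by apply: before_bump_lt => //; lia.
  + by apply: s1'.
- apply/aboveP; rewrite sz; split; first by lia.
  move=> j ltj; rewrite nr; case: eqVneq => [ej|nej].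
    by apply: after_bump => //; lia.
  have := ab j; rewrite nth_row_insert -/k2.
  case: eqVneq => [ej|_]; last by apply; lia.
  move=> H; apply: (@ltn_trans y); first by apply: H; lia.
  by apply: after_bump => //; lia.
- by rewrite /bumped Ek nr eqxx.
- apply: (@eq_from_nth _ 0); rewrite size_row_insert sz Ek; first lia.
  by move=> j _; rewrite nth_row_insert Ek nr; case: eqVneq => [->|].
Qed.

(** Reverse insertion from the last box of row [i]: in row [0] that box is simply removed, otherwise
    the value expelled from the lower rows is pushed into the top row by [row_unbump]. That [s] is a
    tableau ensures that the removed box is a corner. *)
Lemma rinsert_surj P s i k :
  is_tab P -> uniq (flatten P) -> is_tab s -> i <= size s ->
  shape P = shape (addbox s i k) ->
  exists t x, [/\ is_tab t, shape t = shape s & rinsert t x = (P, i)].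
Proof.
elim: s P i => [|r s IH] P [|i] //.
- case: P => [|r1 [|? ?]] //; case: r1 => [|x [|? ?]] // _ _ _ _ _.
  by exists [::], x.
- case: P => [//|r1 P] /is_tab_consP[_ s1 ab tP] uP /is_tab_consP[r0 sr /aboveP[abs _] ts] _.
  rewrite addboxE => -[]; rewrite size_rcons.
  case/lastP: r1 => [//|r1 x] in s1 ab uP *; rewrite size_rcons => -[e1] e2.
  move: (s1); rewrite sorted_rcons => /andP[s1' _].
  have eh : size (head [::] P) = size (head [::] s).
    by case: (P) (s) e2 => [|? ?] [|? ?] //= [].
  exists (r1 :: P), x; split.
  + rewrite /= e1 r0 s1' tP andbT /=; apply/aboveP; rewrite eh e1; split=> // j ltj.
    have /aboveP[_ ab'] := ab; have := ab' j.
    by rewrite eh nth_rcons e1 (leq_trans ltj abs); apply.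
  + by rewrite /shape /= e1; congr (_ :: _).
  have Eb : bump_index r1 x = size r1.
    apply: bump_index_uniq; rewrite ?ltnn // => j ltj; apply: ltnW.
    have := sorted_ltnP _ s1 j (size r1); rewrite size_rcons !nth_rcons ltj ltnn eqxx.
    by apply.
  by rewrite rinsert_cons Eb ltnn row_insert_rcons.
case: P => [|r1 P]; first by rewrite addboxE.
move=> /is_tab_consP[_ s1 ab tP].
rewrite [flatten _]/= cat_uniq => /and3P[ur disj uP] /is_tab_consP[r0 sr _ ts] le.
rewrite addboxE => -[e1 e2].
have [t [y [tt st Et]]] := IH P i tP uP ts le e2.
have hP := head_rinsert t y; rewrite Et /= in hP; rewrite hP in ab.
have sh : sorted ltn (head [::] t) by case: (t) tt => //= ? ? /is_tab_consP[].
have yr : y \notin r1.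
  apply: contra disj => yr; apply/hasP; exists y => //.
  by have := perm_mem (perm_rinsert t y) y; rewrite Et mem_head.
have [r' [x [[sz s' ab'] [lt Ey Er]]]] := row_unbump s1 sh yr ab.
exists (r' :: t), x; split.
- by rewrite /= sz e1 r0 s' ab' tt.
- by rewrite /shape /= sz e1; congr (_ :: _).
- by rewrite rinsert_cons lt Ey Er Et.
Qed.

Lemma addbox_inj Q1 Q2 i1 i2 k :
  is_tab Q1 -> is_tab Q2 -> i1 <= size Q1 -> i2 <= size Q2 ->
  k \notin flatten Q1 -> k \notin flatten Q2 ->
  addbox Q1 i1 k = addbox Q2 i2 k -> Q1 = Q2 /\ i1 = i2.
Proof.
elim: Q1 Q2 i1 i2 => [|r1 t1 IH] [|r2 t2] [|i1] [|i2] // T1 T2 le1 le2;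
  rewrite /= ?mem_cat ?negb_or ?addboxE.
- by case/is_tab_consP: T2 => ? _ _ _ _ _ [/(congr1 size)]; rewrite size_rcons /=; lia.
- by move=> _ /andP[k2 _] [E _]; rewrite -E mem_head in k2.
- by case/is_tab_consP: T1 => ? _ _ _ _ _ [/(congr1 size)]; rewrite size_rcons /=; lia.
- by move=> /andP[k2 _] _ [E _]; rewrite E mem_head in k2.
- by move=> _ _ [/rcons_inj[->] ->].
- by move=> _ /andP[k2 _] [E _]; rewrite -E mem_rcons mem_head in k2.
- by move=> /andP[k2 _] _ [E _]; rewrite E mem_rcons mem_head in k2.
move=> /andP[_ k1] /andP[_ k2] [-> E].
have /is_tab_consP[_ _ _ {}T1] := T1; have /is_tab_consP[_ _ _ {}T2] := T2.
by have [-> ->] := IH t2 i1 i2 T1 T2 le1 le2 k1 k2 E.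
Qed.

(** * Standard tableaux and the rows of their entries *)

Lemma cols_incrP t :
  reflect (forall i j, j < size (nth [::] t i.+1) -> entry t i j < entry t i.+1 j)
          (cols_incr t).
Proof.
apply: (iffP forallP) => [H i j ltj | H i]; last first.
  by apply/forallP => j; apply: H.
have lti : i < size t.
  by rewrite ltnNge; apply/negP => le; rewrite nth_default // in ltj; lia.
by have /forallP/(_ (Ordinal ltj)) := H (Ordinal lti).
Qed.

Lemma is_tabE t : is_tab t = [&& is_shape_ok t, rows_incr t & cols_incr t].
Proof.
elim: t => [|r t IH].
  by apply/esym/and3P; split=> //; apply/cols_incrP => i j; rewrite nth_nil.
have Eh : path geq (size r) (map size t) =
          (size (head [::] t) <= size r) && sorted geq (map size t).
  by case: (t).
rewrite /= {}IH /is_shape_ok /rows_incr /= Eh.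
apply/idP/idP.
  case/and4P => -> -> /aboveP[-> ab] /and3P[/andP[-> ->] -> /cols_incrP cl] /=.
  by apply/cols_incrP => -[|i] j; [rewrite /entry /= nth0; apply: ab | apply: cl].
case/and3P => /andP[/andP[-> ->] /andP[le ->]] /andP[-> ->] /cols_incrP cl /=.
apply/andP; split; last by apply/cols_incrP => i j; apply: (cl i.+1 j).
apply/aboveP; split=> // j ltj; have := cl 0 j.
by rewrite /entry /= nth0; apply.
Qed.

Lemma SYTE m t : SYT m t = is_tab t && perm_eq (flatten t) (iota 1 m).
Proof. by rewrite is_tabE /SYT !andbA. Qed.

Lemma row_of_cons r t x :
  row_of (r :: t) x = if x \in r then 0 else (row_of t x).+1.
Proof. by []. Qed.

Lemma row_of_addbox_new t i k :
  i <= size t -> k \notin flatten t -> row_of (addbox t i k) k = i.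
Proof.
elim: t i => [|r t IH] [|i] //; rewrite ?addboxE ?row_of_cons ?mem_rcons ?mem_head //.
by move=> le; rewrite /= mem_cat negb_or => /andP[/negbTE -> H]; rewrite IH.
Qed.

Lemma row_of_addbox_old t i k x :
  x \in flatten t -> x != k -> row_of (addbox t i k) x = row_of t x.
Proof.
move=> xt ne; elim: t i xt => [//|r t IH] [|i]; rewrite addboxE !row_of_cons /=.
  by rewrite mem_rcons inE (negbTE ne).
by rewrite mem_cat; case: (x \in r) => //= H; rewrite IH.
Qed.

(** The reading word lists lower rows first, so [k+1] precedes [k] when it lies in a lower row;
    inside a common row the order is increasing. *)
Lemma row_of_ltE t k :
  is_tab t -> uniq (flatten t) -> k \in flatten t -> k.+1 \in flatten t ->
  (row_of t k < row_of t k.+1) =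
  (filter (pred2 k k.+1) (reading t) == [:: k.+1; k]).
Proof.
elim: t => [//|r t IH] /is_tab_consP[r0 sr _ tt]; rewrite !row_of_cons reading_cons.
rewrite /= cat_uniq !mem_cat filter_cat => /and3P[ur disj ut].
have ndis z : z \in r -> z \notin flatten t.
  by move=> zr; apply: contra disj => zt; apply/hasP; exists z.
have f1 (s : seq nat) z : uniq s -> z \in s -> filter (pred1 z) s = [:: z].
  by move=> us zs; rewrite filter_pred1_uniq.
have fr0 s : k \notin s -> k.+1 \notin s -> filter (pred2 k k.+1) s = [::].
  move=> n1 n2; rewrite -(filter_pred0 s); apply: eq_in_filter => z zs /=.
  by case: eqP => [E|_]; [rewrite -E zs in n1 | case: eqP => // E; rewrite -E zs in n2].
have frk s : uniq s -> k \in s -> k.+1 \notin s -> filter (pred2 k k.+1) s = [:: k].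
  move=> us i1 n2; rewrite -(f1 s k us i1); apply: eq_in_filter => z zs /=.
  by rewrite orbC; case: eqP => // E; rewrite -E zs in n2.
have frS s : uniq s -> k \notin s -> k.+1 \in s -> filter (pred2 k k.+1) s = [:: k.+1].
  move=> us n1 i2; rewrite -(f1 s k.+1 us i2); apply: eq_in_filter => z zs /=.
  by case: eqP => // E; rewrite -E zs in n1.
have [kr|kr] := boolP (k \in r); have [kSr|kSr] := boolP (k.+1 \in r) => /= k1 k2.
- rewrite (fr0 (reading t)) ?mem_reading ?ndis // cat0s ltnn; apply/esym/eqP => E.
  have : sorted ltn (filter (pred2 k k.+1) r) by apply: sorted_filter => //; apply: ltn_trans.
  by rewrite E /=; lia.
- rewrite (frk r) // (frS (reading t)) ?mem_reading ?ndis //=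
    ?(perm_uniq (perm_reading t)) ?eqxx //.
- rewrite (frS r) // (frk (reading t)) ?mem_reading ?ndis //= ?(perm_uniq (perm_reading t)) //.
    by apply/esym/eqP => -[]; lia.
- by rewrite ltnS IH // (fr0 r) ?cats0.
Qed.

(** * The Robinson-Schensted correspondence *)

(** [rsk_rec] consumes words from the left, whereas the inductions on RSK remove the last letter. *)
Lemma rsk_rec_rcons w x P Q k :
  rsk_rec (rcons w x) P Q k =
  ((rinsert (rsk_rec w P Q k).1 x).1,
   addbox (rsk_rec w P Q k).2 (rinsert (rsk_rec w P Q k).1 x).2 (k + size w)).
Proof.
elim: w P Q k => [|y w IH] P Q k /=; first by rewrite addn0; case: rinsert.
by case: (rinsert P y) => P' i; rewrite IH addSnnS.
Qed.

Lemma RSK_rcons w x :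
  RSK (rcons w x) = ((rinsert (RSK w).1 x).1,
                     addbox (RSK w).2 (rinsert (RSK w).1 x).2 (size w).+1).
Proof. by rewrite /RSK rsk_rec_rcons add1n. Qed.

Lemma iota1_rcons m : perm_eq (iota 1 m.+1) (m.+1 :: iota 1 m).
Proof. by rewrite -{1}(addn1 m) iotaD add1n -(cat1s m.+1) perm_catC. Qed.

Lemma SYT_mem m Q x : SYT m Q -> (x \in flatten Q) = (0 < x <= m).
Proof.
by rewrite SYTE => /andP[_ /perm_mem ->]; rewrite mem_iota add1n ltnS.
Qed.

Lemma size_shape (t1 t2 : tableau) : shape t1 = shape t2 -> size t1 = size t2.
Proof. by move/(congr1 size); rewrite !size_map. Qed.

Lemma RSK_tableaux w : uniq w ->
  [/\ is_tab (RSK w).1, perm_eq (flatten (RSK w).1) w,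
      shape (RSK w).1 = shape (RSK w).2 & SYT (size w) (RSK w).2].
Proof.
elim/last_ind: w => [|w x IH]; first by rewrite SYTE.
rewrite rcons_uniq RSK_rcons size_rcons => /andP[xw uw].
have [] := IH uw; move: (RSK w) => [P Q] /= tP pP sh SQ.
have uP : uniq (x :: flatten P).
  by rewrite cons_uniq (perm_uniq pP) uw (perm_mem pP) xw.
have tP' := is_tab_rinsert tP uP.
have sh' : shape (rinsert P x).1 = shape (addbox Q (rinsert P x).2 (size w).+1).
  by rewrite (shape_rinsert P x 0); apply: shape_addbox.
split=> //.
  by rewrite (perm_trans (perm_rinsert P x)) // perm_sym perm_rcons perm_cons perm_sym.
have := SQ; rewrite !SYTE => /andP[tQ pQ].
apply/andP; split.
  apply: is_tab_addbox tQ _ _ tP' sh'.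
    by rewrite -(size_shape sh) rinsert_row_size.
  by apply/allP => z; rewrite (SYT_mem _ SQ) => /andP[].
apply: perm_trans (perm_addbox _ _ _) _.
by rewrite perm_sym (perm_trans (iota1_rcons _)) // perm_cons perm_sym.
Qed.

Lemma RSK_inj w1 w2 : uniq w1 -> uniq w2 -> size w1 = size w2 ->
  RSK w1 = RSK w2 -> w1 = w2.
Proof.
elim/last_ind: w1 w2 => [|w1 x1 IH] w2; case/lastP: w2 => [|w2 x2] //;
  rewrite ?size_rcons //.
rewrite !rcons_uniq => /andP[n1 u1] /andP[n2 u2] [Es].
have [t1 _ _ _] := RSK_tableaux u1; have [t2 _ _ _] := RSK_tableaux u2.
rewrite !RSK_rcons Es => -[EP EQ].
have nQ w : uniq w -> (size w).+1 \notin flatten (RSK w).2.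
  by move=> uw; have [_ _ _ S] := RSK_tableaux uw; rewrite (SYT_mem _ S) ltnn andbF.
have tQ w : uniq w -> is_tab (RSK w).2.
  by move=> uw; have [_ _ _] := RSK_tableaux uw; rewrite SYTE => /andP[].
have leQ w x : uniq w -> (rinsert (RSK w).1 x).2 <= size (RSK w).2.
  move=> uw; have [_ _ s _] := RSK_tableaux uw.
  by rewrite -(size_shape s) rinsert_row_size.
have n1' : (size w2).+1 \notin flatten (RSK w1).2 by rewrite -Es nQ.
have [EQ' Ei] := addbox_inj (tQ _ u1) (tQ _ u2) (leQ _ _ u1) (leQ _ _ u2)
  n1' (nQ _ u2) EQ.
have uP w x : uniq w -> x \notin w -> uniq (x :: flatten (RSK w).1).
  move=> uw xw; have [_ p _ _] := RSK_tableaux uw.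
  by rewrite cons_uniq (perm_uniq p) (perm_mem p) xw.
have [|EP' ->] := rinsert_inj t1 t2 (uP _ _ u1 n1) (uP _ _ u2 n2).
  by rewrite [LHS]surjective_pairing [RHS]surjective_pairing EP Ei.
congr (rcons _ _); apply: IH => //.
by rewrite [LHS]surjective_pairing [RHS]surjective_pairing EP' EQ'.
Qed.

(** [P] is only assumed to have distinct entries: undoing an insertion removes the maximum from [Q]
    but an arbitrary value from [P]. *)
Lemma RSK_surj m P Q : is_tab P -> uniq (flatten P) -> SYT m Q ->
  shape P = shape Q -> exists w, perm_eq w (flatten P) /\ RSK w = (P, Q).
Proof.
elim: m P Q => [|m IH] P Q tP uP SQ sh.
  have Q0 : Q = [::].
    move: SQ; rewrite SYTE; case: (Q) => [//|[|a r] t] /andP[//].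
    by move=> _ /perm_size.
  have P0 : P = [::] by move: sh; rewrite Q0; case: (P).
  by exists [::]; rewrite P0 Q0.
have := SQ; rewrite SYTE => /andP[tQ pQ].
have uQ : uniq (flatten Q) by rewrite (perm_uniq pQ) iota_uniq.
have [||Q0 [i [tQ0 le EQ]]] := @is_tab_split_max Q m.+1 tQ uQ.
- by rewrite (SYT_mem _ SQ) leqnn.
- by apply/allP => z; rewrite (SYT_mem _ SQ) => /andP[].
have SQ0 : SYT m Q0.
  rewrite SYTE tQ0 -(perm_cons m.+1).
  rewrite -(permPr (iota1_rcons m)) -(permPr pQ) EQ perm_sym.
  exact: perm_addbox.
rewrite EQ in sh; have [t [x [tt st Et]]] := rinsert_surj tP uP tQ0 le sh.
have pt := perm_rinsert t x; rewrite Et /= in pt.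
have ut : uniq (flatten t).
  by move: uP; rewrite (perm_uniq pt) cons_uniq => /andP[].
have [w [pw Ew]] := IH t Q0 tt ut SQ0 st.
have sw : size w = m.
  have /perm_size := pw; have : size (flatten t) = size (flatten Q0).
    by rewrite !size_flatten; congr sumn; exact: st.
  by move: SQ0; rewrite SYTE => /andP[_ /perm_size]; rewrite size_iota => -> -> ->.
exists (rcons w x); split.
  by rewrite perm_rcons perm_sym (perm_trans pt) // perm_cons perm_sym.
by rewrite RSK_rcons Ew Et EQ sw.
Qed.

(** Later steps do not move recorded entries, so only the two insertions at positions [k] and [k+1]
    matter, and the row bumping lemmas compare them. Labels in [Q] start at [1], positions in [w] at
    [0]. *)
Lemma RSK_recording_descent w k : uniq w -> k.+1 < size w ->
  (row_of (RSK w).2 k.+1 < row_of (RSK w).2 k.+2) =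
  (nth 0 w k.+1 < nth 0 w k).
Proof.
elim/last_ind: w => [//|w x IH].
rewrite rcons_uniq size_rcons => /[dup] uwx /andP[xw uw] ltk.
have [tP pP sh SQ] := RSK_tableaux uw; rewrite RSK_rcons [(_, _).2]/=.
have lei : (rinsert (RSK w).1 x).2 <= size (RSK w).2.
  by rewrite -(size_shape sh) rinsert_row_size.
move: ltk; rewrite ltnS leq_eqVlt => /orP[/eqP Ek|ltk]; last first.
  rewrite !row_of_addbox_old ?(SYT_mem _ SQ) ?eqSS ?ltn_eqF ?(ltnW ltk) //.
  by rewrite IH // !nth_rcons ltk (ltnW ltk).
rewrite -Ek row_of_addbox_new ?row_of_addbox_old ?(SYT_mem _ SQ) -?Ek ?leqnn //;
  [|by rewrite ltn_eqF|by rewrite ltnn andbF].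
case/lastP: w => [//|w y] in IH uwx xw uw tP pP sh SQ lei Ek *.
rewrite size_rcons in Ek; case: Ek => Ek.
rewrite rcons_uniq in uw; have /andP[yw uw'] := uw.
have [tP' pP' sh' SQ'] := RSK_tableaux uw'.
rewrite Ek !nth_rcons !size_rcons ltnn eqxx ltnSn ltnn eqxx.
rewrite (RSK_rcons w y) /= row_of_addbox_new; last 2 first.
- by rewrite -(size_shape sh') rinsert_row_size.
- by rewrite (SYT_mem _ SQ') ltnn.
case: (ltngtP x y) => [lt|gt|e].
- by rewrite row_bumping_strict.
- by apply/negbTE; rewrite -leqNgt row_bumping_weak.
- by rewrite mem_rcons inE e eqxx in xw.
Qed.

Lemma RSK_filter w k : uniq w ->
  filter (pred2 k k.+1) (reading (RSK w).1) = filter (pred2 k k.+1) w.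
Proof.
elim/last_ind: w => [//|w x IH]; rewrite rcons_uniq => /andP[xw uw].
have [tP pP _ _] := RSK_tableaux uw; rewrite RSK_rcons [(_, _).1]/=.
rewrite filter_reading_rinsert ?filter_rcons ?IH //.
by rewrite cons_uniq (perm_uniq pP) (perm_mem pP) xw.
Qed.

(** The first row evolves independently of the others ([head_rinsert]). *)
Lemma RSK_patience w : uniq w -> patience w (head [::] (RSK w).1).
Proof.
elim/last_ind: w => [_|w x IH]; first by split=> // u /eqP ->.
rewrite rcons_uniq => /andP[xw uw]; have [tP pP _ _] := RSK_tableaux uw.
rewrite RSK_rcons head_rinsert; apply: patience_row_insert; last exact: IH.
  by case: (RSK w).1 tP => // r t /is_tab_consP[].
rewrite -(perm_mem pP) in xw; apply: contra xw.
by case: (RSK w).1 => // r t /=; rewrite mem_cat => ->.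
Qed.

(** * Configurations of regular multigraphs *)

Lemma card_ord_interval m a b : b <= m -> #|[set x : 'I_m | a <= x < b]| = b - a.
Proof.
move=> lebm; rewrite cardsE -sum1_card.
transitivity (\sum_(a <= i < b) 1); last by rewrite sum_nat_const_nat muln1.
rewrite -(big_mkord (fun i => a <= i < b) (fun _ => 1)).
rewrite (big_nat_widenl a 0) // (big_nat_widen 0 b m) //=.
Qed.

Lemma block_proof n r (x : 'I_(r * n)) : x %/ r < n.
Proof. by case: r x => [|r] [x ltx] //=; rewrite ltn_divLR // mulnC. Qed.

Definition block n r (x : 'I_(r * n)) : 'I_n := Ordinal (block_proof x).

Lemma block_divn_eq n r (x : 'I_(r * n)) : r * block x + x %% r = x.
Proof. by move: (divn_eq x r); rewrite [x %/ r * r]mulnC => <-. Qed.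

Lemma block_pos n r (x : 'I_(r * n)) : 0 < r.
Proof. by case: r x => [|//] []. Qed.

Lemma block_eq n r (x : 'I_(r * n)) (a : 'I_n) :
  (block x == a) = (r * a <= x < r * a + r).
Proof.
rewrite -val_eqE /= eqn_leq andbC leq_divRL ?(block_pos x) // -[_ %/ _ <= _]ltnS.
by rewrite ltn_divLR ?(block_pos x) // mulSn addnC mulnC.
Qed.

Lemma block_lt n r (x y : 'I_(r * n)) : block x < block y -> x < y.
Proof. by apply: contraTT; rewrite -!leqNgt => /leq_div2r; apply. Qed.

Lemma mul_add_offset n r (a : 'I_n) p : p < r -> r * a + p < r * n.
Proof.
move=> ltp; apply: (@leq_trans (r * a.+1)); first by rewrite mulnS addnC ltn_add2r.
by rewrite leq_mul2l ltn_ord orbT.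
Qed.

Lemma offset_inj n r (a b : 'I_n) p q :
  p < r -> q < r -> r * a + p = r * b + q -> a = b /\ p = q.
Proof.
move=> ltp ltq E; have r0 : 0 < r by lia.
have Ea : a = b :> nat.
  by have := congr1 (divn ^~ r) E; rewrite /= ![r * _]mulnC !divnMDl // !divn_small // !addn0.
by split; [exact: val_inj | move: E; rewrite Ea => /addnI].
Qed.

(** * Slots occupied by the edges of a multigraph *)

(** For the multiplicities at one vertex this is the offset [i] or [j] of the associated
    configuration: the copies taken by later neighbours come first. *)
Definition tail_sum n (f : 'I_n -> nat) (b : 'I_n) := \sum_(b' : 'I_n | b < b') f b'.

Lemma tail_sum_lt n (f : 'I_n -> nat) (b b' : 'I_n) :
  b < b' -> tail_sum f b' + f b' <= tail_sum f b.
Proof.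
move=> lt; rewrite {2}/tail_sum (bigD1 b') //= addnC leq_add2l.
rewrite /tail_sum big_mkcond [X in _ <= X]big_mkcond leq_sum // => i _.
case: (ltnP b' i) => // lt'.
by rewrite (ltn_trans lt lt') -val_eqE gtn_eqF.
Qed.

Lemma tail_sum_le n (f : 'I_n -> nat) b : tail_sum f b + f b <= \sum_i f i.
Proof.
rewrite (bigD1 b) //= addnC leq_add2l.
rewrite /tail_sum big_mkcond [X in _ <= X]big_mkcond leq_sum // => i _.
by case: (ltnP b i) => // lt; rewrite -val_eqE gtn_eqF.
Qed.

Lemma slot_uniq n (f : 'I_n -> nat) b b' c c' :
  c < f b -> c' < f b' -> tail_sum f b + c = tail_sum f b' + c' ->
  b = b' /\ c = c'.
Proof.
move=> ltc ltc' E; have := @tail_sum_lt n f b b'; have := @tail_sum_lt n f b' b.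
case: (ltngtP b b') => [_ _ /(_ isT)|_ /(_ isT)|e _ _]; [lia|lia|].
have e' : b = b' by apply: val_inj.
by split=> //; move: E; rewrite e' => /addnI.
Qed.

Lemma slot_exists n (f : 'I_n -> nat) p : p < \sum_i f i ->
  exists b c, c < f b /\ p = tail_sum f b + c.
Proof.
case: n f => [|n] f; first by rewrite big_ord0.
move=> ltp; pose P b := p < tail_sum f b + f b.
have P0 : P ord0.
  rewrite /P addnC; rewrite (bigD1 ord0) //= in ltp; apply: leq_trans ltp _.
  rewrite leq_add2l /tail_sum (eq_bigl (fun i : 'I_n.+1 => 0 < i)) // => i.
  by rewrite -val_eqE /= lt0n.
(* The slots run backwards from the last index, so the right [b] is the largest whose slot ends
   after [p]: if its slot began after [p], then [b+1] would qualify as well. *)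
case: (@arg_maxnP _ ord0 P (fun b : 'I_n.+1 => b : nat) P0) => b Pb maxb.
suff le : tail_sum f b <= p.
  exists b, (p - tail_sum f b); split; last by rewrite subnKC.
  by move: Pb; rewrite /P; lia.
rewrite leqNgt; apply/negP => lt.
have [ltb|geb] := ltnP b.+1 n.+1; last first.
  by move: lt; rewrite /tail_sum big1 // => i; have := ltn_ord i; lia.
have := maxb (Ordinal ltb); rewrite /P /= => H; suff: b.+1 <= b by rewrite ltnn.
apply: H; apply: leq_trans lt _.
rewrite {1}/tail_sum (bigD1 (Ordinal ltb)) //= addnC leq_add2r.
rewrite /tail_sum (eq_bigl (fun i : 'I_n.+1 => b.+1 < i)) // => i.
by rewrite -val_eqE /= (ltn_neqAle b.+1) eq_sym andbC.
Qed.

(* Every pair of the configuration is (u_a^{i+s}, v_b^{j+t-s+1}), with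
   [s = c.+1], [i] and [j] the two tail sums and [t = M a b]. *)
Definition slotted n r (M : 'I_n -> 'I_n -> nat) (s : {perm 'I_(r * n)}) : Prop :=
  forall x : 'I_(r * n), exists a b c,
    [/\ c < M a b, x = r * a + (tail_sum (M a) b + c) :> nat
      & s x = r * b + (tail_sum (M^~ b) a + (M a b - c.+1)) :> nat].

Definition biregular n r (M : 'I_n -> 'I_n -> nat) : Prop :=
  (forall a, \sum_b M a b = r) /\ (forall b, \sum_a M a b = r).

Lemma biregular_tr n r (M : 'I_n -> 'I_n -> nat) :
  biregular r M -> biregular r (fun a b => M b a).
Proof. by case. Qed.

(** Reversing parallel edges makes the definition symmetric in [U] and [V], under the change of copy
    number from [c] to [M a b - c.+1]. *)
Lemma slotted_inv n r (M : 'I_n -> 'I_n -> nat) (s : {perm 'I_(r * n)}) :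
  slotted M s -> slotted (fun a b => M b a) s^-1%g.
Proof.
move=> H y; have [a [b [c [ltc Ex Ey]]]] := H (s^-1%g y).
rewrite permKV in Ey; exists b, a, (M a b - c.+1); split=> //; first by lia.
by rewrite Ex; congr (_ + (_ + _)); lia.
Qed.

Lemma slot_row_lt n r (M : 'I_n -> 'I_n -> nat) a b c :
  biregular r M -> c < M a b -> tail_sum (M a) b + c < r.
Proof.
by move=> [row _] ltc; have := tail_sum_le (M a) b; rewrite row; lia.
Qed.

Lemma slot_col_lt n r (M : 'I_n -> 'I_n -> nat) a b c :
  biregular r M -> c < M a b -> tail_sum (M^~ b) a + (M a b - c.+1) < r.
Proof.
by move=> [_ col] ltc; have := tail_sum_le (M^~ b) a; rewrite col; lia.
Qed.

Lemma slotted_uniq n r (M : 'I_n -> 'I_n -> nat) (s s' : {perm 'I_(r * n)}) :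
  biregular r M -> slotted M s -> slotted M s' -> s = s'.
Proof.
move=> reg H H'; apply/permP => x; apply: val_inj.
have [a [b [c [ltc Ex Ey]]]] := H x; have [a' [b' [c' [ltc' Ex' Ey']]]] := H' x.
have [Ea Ep] := offset_inj (slot_row_lt reg ltc) (slot_row_lt reg ltc') (etrans (esym Ex) Ex').
move: ltc' Ep Ey'; rewrite -Ea => ltc' Ep Ey'.
have [Eb Ec] := slot_uniq ltc ltc' Ep.
by rewrite /= Ey Ey' Eb Ec.
Qed.

(** Slots cover every block of [U], which defines the map; slots in a block of [V] are disjoint,
    which makes it injective. *)
Lemma slotted_exists n r (M : 'I_n -> 'I_n -> nat) :
  biregular r M -> exists s : {perm 'I_(r * n)}, slotted M s.
Proof.
move=> reg; pose P (x y : 'I_(r * n)) := exists a b c,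
    [/\ c < M a b, x = r * a + (tail_sum (M a) b + c) :> nat
      & y = r * b + (tail_sum (M^~ b) a + (M a b - c.+1)) :> nat].
have [x|f Hf] := @fin_all_exists _ (fun=> 'I_(r * n)) P.
  have ltp : x %% r < \sum_b M (block x) b by rewrite reg.1 ltn_mod (block_pos x).
  have [b [c [ltc Ep]]] := slot_exists ltp.
  exists (Ordinal (mul_add_offset b (slot_col_lt reg ltc))), (block x), b, c; split=> //.
  by rewrite -Ep block_divn_eq.
have f_inj : injective f.
  move=> x x' E; apply: val_inj.
  have [a [b [c [ltc Ex Ey]]]] := Hf x; have [a' [b' [c' [ltc' Ex' Ey']]]] := Hf x'.
  rewrite -E in Ey'.
  have [Eb Ep] := offset_inj (slot_col_lt reg ltc) (slot_col_lt reg ltc') (etrans (esym Ey) Ey').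
  move: ltc' Ep Ex'; rewrite -Eb => ltc' Ep Ex'.
  have [||Ea Ec] := slot_uniq (f := M^~ b) _ _ Ep; try lia.
  move: ltc' Ec Ex'; rewrite -Ea => ltc' Ec Ex'.
  by rewrite /= Ex Ex'; congr (_ + (_ + _)); lia.
by exists (perm f_inj) => x; rewrite permE; apply: Hf.
Qed.

(** * Permutations decreasing on blocks *)

Definition block_decreasing n r (s : {perm 'I_(r * n)}) : Prop :=
  forall x y : 'I_(r * n), block x = block y -> x < y -> s y < s x.

Lemma block_offset n r (x : 'I_(r * n)) (a : 'I_n) p :
  p < r -> x = r * a + p :> nat -> block x = a.
Proof. by move=> ltp E; apply/eqP; rewrite block_eq E leq_addr ltn_add2l. Qed.

Lemma slotted_block_decreasing n r (M : 'I_n -> 'I_n -> nat) (s : {perm 'I_(r * n)}) :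
  biregular r M -> slotted M s -> block_decreasing s.
Proof.
move=> reg H x x' Eb ltx.
have [a [b [c [ltc Ex Ey]]]] := H x; have [a' [b' [c' [ltc' Ex' Ey']]]] := H x'.
have Ea : a = a'.
  by rewrite -(block_offset (slot_row_lt reg ltc) Ex) Eb (block_offset (slot_row_lt reg ltc') Ex').
move: ltc' Ex' Ey'; rewrite -Ea => ltc' Ex' Ey'.
case: (ltngtP b b') => [lt|gt|e].
- by have := tail_sum_lt (M a) lt; lia.
- apply: block_lt.
  rewrite (block_offset (slot_col_lt reg ltc) Ey) (block_offset (slot_col_lt reg ltc') Ey').
  exact: gt.
- have e' : b = b' by apply: val_inj.
  by rewrite Ey Ey' -e' in ltc' Ex' *; lia.
Qed.

Definition contraction n r (s : {perm 'I_(r * n)}) (a b : 'I_n) : nat :=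
  #|[set x : 'I_(r * n) | (block x == a) && (block (s x) == b)]|.

(** The edges between [a] and [b] occupy exactly the interval of length [M a b] starting at [lo]. In
    particular the permutation determines the multigraph. *)
Lemma slotted_contraction n r (M : 'I_n -> 'I_n -> nat) (s : {perm 'I_(r * n)}) a b :
  biregular r M -> slotted M s -> M a b = contraction s a b.
Proof.
move=> reg H; set lo := r * a + tail_sum (M a) b.
have hi : lo + M a b <= r * n.
  case: (posnP (M a b)) => [->|M0].
    rewrite addn0 /lo; have := tail_sum_le (M a) b; rewrite reg.1 => le.
    apply: (@leq_trans (r * a.+1)); last by rewrite leq_mul2l ltn_ord orbT.
    by rewrite mulnS; lia.
  have lt : (M a b).-1 < M a b by lia.
  by have := mul_add_offset a (slot_row_lt reg lt); rewrite /lo; lia.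
have <- : #|[set x : 'I_(r * n) | lo <= x < lo + M a b]| = M a b.
  by rewrite card_ord_interval // addKn.
apply: eq_card => x; rewrite !inE.
have [a' [b' [c [ltc Ex Ey]]]] := H x.
rewrite (block_offset (slot_row_lt reg ltc) Ex) (block_offset (slot_col_lt reg ltc) Ey).
apply/idP/andP => [lex|[/eqP Ea /eqP Eb]]; last by rewrite /lo Ex Ea Eb in ltc *; lia.
have ltd : x - lo < M a b by lia.
have E : r * a' + (tail_sum (M a') b' + c) = r * a + (tail_sum (M a) b + (x - lo)).
  by rewrite -Ex /lo; rewrite /lo in lex; lia.
have [Ea Ep] := offset_inj (slot_row_lt reg ltc) (slot_row_lt reg ltd) E.
move: ltc Ep; rewrite Ea => ltc Ep; have [Eb _] := slot_uniq ltc ltd Ep.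
by rewrite Eb !eqxx.
Qed.

Lemma card_fibers (T I : finType) (A : pred T) (P : pred I) (g : T -> I) :
  \sum_(i | P i) #|[set x | A x && (g x == i)]| = #|[set x | A x && P (g x)]|.
Proof.
rewrite -sum1_card (partition_big g P) => [|x]; last by rewrite inE => /andP[].
apply: eq_bigr => i Pi; rewrite -sum1_card; apply: eq_bigl => x.
by rewrite !inE -andbA; case: eqP => [->|]; rewrite ?andbF ?Pi.
Qed.

Lemma contraction_inv n r (s : {perm 'I_(r * n)}) a b :
  contraction s^-1%g b a = contraction s a b.
Proof.
rewrite /contraction -[RHS](card_imset _ (@perm_inj _ s)); apply: eq_card => y.
rewrite !inE; apply/andP/imsetP => [[yb ya]|[x]].
  by exists (s^-1%g y); rewrite ?inE ?permKV ?ya.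
by rewrite inE => /andP[xa xb] ->; rewrite permK.
Qed.

Lemma card_block n r (a : 'I_n) : #|[set x : 'I_(r * n) | block x == a]| = r.
Proof.
rewrite -[RHS](addKn (r * a)) -(@card_ord_interval (r * n)).
  by apply: eq_card => x; rewrite !inE block_eq.
by rewrite -mulnSr leq_mul2l ltn_ord orbT.
Qed.

Lemma contraction_biregular n r (s : {perm 'I_(r * n)}) : biregular r (contraction s).
Proof.
have row (s' : {perm 'I_(r * n)}) a : \sum_b contraction s' a b = r.
  rewrite card_fibers -[RHS](card_block r a).
  by apply: eq_card => x; rewrite !inE andbT.
split=> // b; rewrite -[RHS](row s^-1%g b).
by apply: eq_bigr => a _; rewrite contraction_inv.
Qed.

Lemma block_rank n r (x : 'I_(r * n)) :
  #|[set x' : 'I_(r * n) | (block x' == block x) && (x' < x)]| = x %% r.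
Proof.
have -> : x %% r = x - r * block x.
  by rewrite -[X in X - _]block_divn_eq addKn.
rewrite -(@card_ord_interval (r * n)); last exact: ltnW.
apply: eq_card => y; rewrite !inE block_eq.
have := block_divn_eq x; have := ltn_pmod x (block_pos x); lia.
Qed.

(** The copy number [c] of a pair among the parallel edges joining its two blocks, read off the
    permutation. *)
Definition fiber_rank n r (s : {perm 'I_(r * n)}) (x : 'I_(r * n)) : nat :=
  #|[set x' : 'I_(r * n) |
      [&& block x' == block x, block (s x') == block (s x) & x' < x]]|.

(** The remainder counts the earlier elements of the block. Since [s] decreases there, these are all
    the elements sent to later blocks, together with the earlier ones sent to the same block. *)
Lemma modn_fiber_rank n r (s : {perm 'I_(r * n)}) (x : 'I_(r * n)) : block_decreasing s ->
  x %% r = tail_sum (contraction s (block x)) (block (s x)) + fiber_rank s x.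
Proof.
move=> dec; rewrite /tail_sum card_fibers -block_rank /fiber_rank.
rewrite -(cardsID [set x' : 'I_(r * n) | block (s x) < block (s x')]).
congr (_ + _); apply: eq_card => y; rewrite !inE.
  case: eqP => //= Eb; rewrite andbC; case: ltnP => //= lt.
  case: (ltngtP y x) => // [ltx|e].
    by have := dec _ _ (esym Eb) ltx; rewrite ltnNge ltnW // block_lt.
  by rewrite (val_inj e) ltnn in lt.
case: eqP => [Eb|]; rewrite ?andbF //=.
case: (ltnP y x) => [ltx|]; rewrite ?andbF // !andbT.
have := dec _ _ Eb ltx => /ltnW /(leq_div2r r) le.
by rewrite -val_eqE /= eqn_leq -leqNgt le andbT.
Qed.

(** [s] reverses the order of a fiber, so the rank of [s x] for the inverse counts the elements
    after [x]; adding [x] and those before it exhausts the fiber. *)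
Lemma fiber_rank_inv n r (s : {perm 'I_(r * n)}) x : block_decreasing s ->
  fiber_rank s^-1%g (s x) + (fiber_rank s x).+1 =
  contraction s (block x) (block (s x)).
Proof.
move=> dec; rewrite /contraction.
rewrite -(cardsID [set x' : 'I_(r * n) | x < x']); congr (_ + _).
  rewrite /fiber_rank -(card_imset _ (@perm_inj _ s^-1%g)); apply: eq_card => y.
  rewrite !inE; apply/imsetP/andP => [[z]|[/andP[/eqP yx ysx] lty]].
    rewrite inE permK => /and3P[zb za ltz] ->; rewrite permKV za zb; split=> //.
    case: (ltngtP x (s^-1%g z)) => // [gt|/val_inj E].
      by have := dec _ _ (eqP za) gt; rewrite permKV; lia.
    by rewrite E permKV ltnn in ltz.
  exists (s y); rewrite ?permK // inE !permK ysx yx eqxx /=; exact: dec.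
rewrite [RHS](cardsD1 x) !inE !eqxx ltnn add1n; congr _.+1.
apply: eq_card => y; rewrite !inE -leqNgt [y < x]ltn_neqAle -val_eqE /=.
by case: (y %/ r == _); case: (block (s y) == _); rewrite ?andbF ?andbT.
Qed.

Lemma block_decreasing_slotted n r (s : {perm 'I_(r * n)}) :
  block_decreasing s -> block_decreasing s^-1%g -> slotted (contraction s) s.
Proof.
move=> dec dec' x; have Er := fiber_rank_inv x dec.
exists (block x), (block (s x)), (fiber_rank s x); split.
- by rewrite -Er; lia.
- by rewrite -modn_fiber_rank // block_divn_eq.
have := modn_fiber_rank (s x) dec'; rewrite permK.
rewrite (_ : tail_sum _ _ = tail_sum ((contraction s)^~ (block (s x))) (block x)).
  by rewrite -Er addnK => <-; rewrite block_divn_eq.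
by apply: eq_bigr => a _; rewrite contraction_inv.
Qed.

(** * Associated configurations as slotted permutations *)

Lemma regular_biregular n r (G : mgraph n r) : regular G -> biregular r (mult G).
Proof.
by case/andP => /forallP row /forallP col; split=> [a|b]; apply/eqP.
Qed.

Lemma conf_pairsP n r (G : mgraph n r) (p : nat * nat) :
  reflect (exists a b c, c < mult G a b /\
      p = (r * a + (tail_sum (mult G a) b + c.+1),
           r * b + (tail_sum ((mult G)^~ b) a + mult G a b - c.+1 + 1)))
    (p \in conf_pairs G).
Proof.
apply: (iffP flatten_mapP) => [[[a b] _ /mapP[s]]|[a [b [c [ltc ->]]]]].
  rewrite mem_iota /= => lts ->; exists a, b, s.-1.
  by rewrite prednK; [split=> //; lia | lia].
exists (a, b); first by rewrite mem_enum inE.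
by apply/mapP; exists c.+1 => //; rewrite mem_iota /=; lia.
Qed.

(** One side says that every pair of the configuration belongs to [s], the other that every pair of
    [s] comes from the configuration. They agree because, by regularity, each element of a block
    lies in exactly one slot. *)
Lemma is_conf_of_slotted n r (G : mgraph n r) (s : {perm 'I_(r * n)}) :
  regular G -> is_conf_of G s <-> slotted (mult G) s.
Proof.
move=> /regular_biregular reg; split=> [H x | H p /conf_pairsP[a [b [c [ltc ->]]]]].
  have ltp : x %% r < \sum_b mult G (block x) b by rewrite reg.1 ltn_mod (block_pos x).
  have [b [c [ltc Ep]]] := slot_exists ltp.
  have Ex := block_divn_eq x; rewrite Ep in Ex.
  have [y [/= Ey Esy]] := H _ (introT (conf_pairsP G _)
    (ex_intro _ (block x) (ex_intro _ b (ex_intro _ c (conj ltc erefl))))).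
  have -> : x = y by apply: val_inj; move: Ex Ey => /=; lia.
  exists (block x), b, c; split=> //; last by lia.
  by move: Ey => /=; lia.
have lt := slot_row_lt reg ltc; pose x := Ordinal (mul_add_offset a lt).
exists x; have [a' [b' [c' [ltc' Ex Ey]]]] := H x.
have [Ea Ep] := offset_inj lt (slot_row_lt reg ltc') Ex.
move: ltc' Ep Ey; rewrite -Ea => ltc' Ep Ey; have [Eb Ec] := slot_uniq ltc ltc' Ep.
by rewrite /= Ey -Eb -Ec; split; lia.
Qed.

(** * Words of configurations *)

Lemma size_perm_word m (s : {perm 'I_m}) : size (perm_word s) = m.
Proof. by rewrite size_map size_enum_ord. Qed.

Lemma nth_perm_word m (s : {perm 'I_m}) (x : 'I_m) : nth 0 (perm_word s) x = (s x).+1.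
Proof. by rewrite (nth_map x) ?size_enum_ord // nth_ord_enum. Qed.

Lemma perm_word_inj m : injective (@perm_word m).
Proof.
move=> s1 s2 E; apply/permP => x; apply: val_inj.
by have := nth_perm_word s1 x; rewrite E nth_perm_word => -[].
Qed.

Lemma uniq_perm_word m (s : {perm 'I_m}) : uniq (perm_word s).
Proof.
by rewrite map_inj_uniq ?enum_uniq // => x y [] /val_inj /perm_inj.
Qed.

Lemma perm_perm_word m (s : {perm 'I_m}) : perm_eq (perm_word s) (iota 1 m).
Proof.
apply: uniq_perm; rewrite ?uniq_perm_word ?iota_uniq // => z; rewrite mem_iota.
apply/mapP/idP => [[x _ ->]|lez]; first by have := ltn_ord (s x); lia.
have ltz : z.-1 < m by lia.
exists (s^-1%g (Ordinal ltz)); rewrite ?mem_enum // permKV /=; lia.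
Qed.

Lemma perm_word_surj m (w : seq nat) : perm_eq w (iota 1 m) ->
  exists s : {perm 'I_m}, perm_word s = w.
Proof.
move=> pw; have sw : size w = m by rewrite (perm_size pw) size_iota.
have uw : uniq w by rewrite (perm_uniq pw) iota_uniq.
have inw (x : 'I_m) : 0 < nth 0 w x <= m.
  have : nth 0 w x \in w by rewrite mem_nth // sw.
  by rewrite (perm_mem pw) mem_iota add1n ltnS.
have lt (x : 'I_m) : (nth 0 w x).-1 < m by have := inw x; lia.
pose f x := Ordinal (lt x).
have f_inj : injective f.
  move=> x y [E]; apply: val_inj; apply/eqP; rewrite /= -(nth_uniq 0 _ _ uw) ?sw ?ltn_ord //.
  have /andP[/prednK <- _] := inw x; have /andP[/prednK <- _] := inw y.
  by rewrite E.
exists (perm f_inj); apply: (@eq_from_nth _ 0); rewrite size_perm_word // => i lti.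
rewrite -[i]/(nat_of_ord (Ordinal lti)) nth_perm_word permE /=.
by have := inw (Ordinal lti); rewrite /=; lia.
Qed.

Lemma index_perm_word m (s : {perm 'I_m}) (x : 'I_m) :
  index x.+1 (perm_word s) = s^-1%g x.
Proof.
rewrite -{1}(permKV s x) -nth_perm_word index_uniq ?uniq_perm_word //.
by rewrite size_perm_word.
Qed.

(** * Condition (T) as descents inside blocks *)

Lemma block_decreasingP n r (s : {perm 'I_(r * n)}) :
  block_decreasing s <->
  (forall x y : 'I_(r * n), block x = block y -> y = x.+1 :> nat -> s y < s x).
Proof.
split=> [H x y Eb Ey|H x y Eb]; first by apply: H => //; rewrite Ey.
have [k] := ubnP (y - x); elim: k y Eb => [//|k IH] y Eb ltk lt.
(* The predecessor [z] of [y] is still in the common block, because blocks are intervals. *)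
have ltz : y.-1 < r * n by have := ltn_ord y; lia.
pose z := Ordinal ltz; have Ez : y = z.+1 :> nat by rewrite /=; lia.
have Exz : block x = block z.
  have := congr1 val Eb; rewrite /= => Exy; apply: val_inj; apply/eqP; rewrite /= eqn_leq.
  by rewrite leq_div2r /= ?Exy ?leq_div2r //; lia.
have lt1 : s y < s z by apply: H => //; rewrite -Eb.
case: (ltngtP x z) => [ltxz||E]; [|by lia|by rewrite (val_inj E)].
by apply: ltn_trans lt1 _; apply: IH => //; lia.
Qed.

Lemma condTP n r (t : tableau) :
  condT n r t <->
  (forall x y : 'I_(r * n), block x = block y -> y = x.+1 :> nat ->
     row_of t x.+1 < row_of t y.+1).
Proof.
split=> [H x y Eb Ey | H i s].
  have := H (block x).+1 (x %% r).+1; rewrite subSS subn0 !addn1 !addnS block_divn_eq Ey.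
  apply; first exact: (ltn_ord (block x)).
  have Bx := block_divn_eq x; have By := block_divn_eq y; rewrite -Eb in By.
  by have := ltn_pmod y (block_pos y); lia.
move=> /andP[i0 lei] /andP[s0 lts].
have lti : i.-1 < n by lia.
have ltp : s.-1 < r by lia.
pose a := Ordinal lti.
pose x := Ordinal (mul_add_offset a ltp); pose y := Ordinal (mul_add_offset a lts).
have Ex : block x = a by exact: (@block_offset n r x a s.-1).
have Ey : block y = a by exact: (@block_offset n r y a s).
have := H x y; rewrite Ex Ey /= subn1 => /(_ erefl).
have -> : (r * i.-1 + s.-1).+1 = r * i.-1 + s by lia.
by rewrite addn1; apply.
Qed.

Lemma condT_recording n r (s : {perm 'I_(r * n)}) :
  condT n r (RSK (perm_word s)).2 <-> block_decreasing s.
Proof.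
rewrite condTP block_decreasingP.
have E (x y : 'I_(r * n)) : y = x.+1 :> nat ->
    (row_of (RSK (perm_word s)).2 x.+1 < row_of (RSK (perm_word s)).2 y.+1) =
    (s y < s x).
  move=> Ey; rewrite Ey RSK_recording_descent ?uniq_perm_word ?size_perm_word -?Ey //.
  by rewrite !nth_perm_word.
by split=> H x y Eb Ey; have := H x y Eb Ey; rewrite E.
Qed.

Lemma filter_pair_index (w : seq nat) i j :
  uniq w -> i != j -> i \in w -> j \in w ->
  (filter (pred2 i j) w == [:: j; i]) = (index j w < index i w).
Proof.
move=> uw ne; elim: w uw => [//|z w IH] /= /andP[zw uw]; rewrite !inE.
rewrite ![_ == z]eq_sym; case: (eqVneq z i) => [zi|ni] /=.
  by rewrite eqseq_cons zi (negbTE ne) ltn0.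
case: (eqVneq z j) => [zj|nj] /=; last by rewrite ltnS; apply: IH.
move=> iw _; rewrite zj eqseq_cons eqxx /=.
rewrite (eq_in_filter (a2 := pred1 i)); last first.
  move=> x xw /=; case: (eqVneq x j) => [E|]; rewrite ?orbF //.
  by rewrite zj -E xw in zw.
by rewrite filter_pred1_uniq // eqxx.
Qed.

(** [k+1] is below [k] in [P] iff it precedes [k] in the reading word, equivalently in the word of
    [s], and positions in that word are values of the inverse. *)
Lemma condT_insertion n r (s : {perm 'I_(r * n)}) :
  condT n r (RSK (perm_word s)).1 <-> block_decreasing s^-1%g.
Proof.
rewrite condTP block_decreasingP; have uw := uniq_perm_word s.
have [tP pP _ _] := RSK_tableaux uw.
have inP (x : 'I_(r * n)) : x.+1 \in flatten (RSK (perm_word s)).1.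
  rewrite (perm_mem pP) (perm_mem (perm_perm_word s)) mem_iota.
  by have := ltn_ord x; lia.
have inw (x : 'I_(r * n)) : x.+1 \in perm_word s by rewrite -(perm_mem pP).
have E (x y : 'I_(r * n)) : y = x.+1 :> nat ->
    (row_of (RSK (perm_word s)).1 x.+1 < row_of (RSK (perm_word s)).1 y.+1) =
    (s^-1%g y < s^-1%g x).
  move=> Ey; have iy := inP y; have wy := inw y; rewrite Ey in iy wy *.
  rewrite row_of_ltE ?(perm_uniq pP) // RSK_filter //.
  rewrite filter_pair_index ?ltn_eqF // -{1}Ey.
  by rewrite !index_perm_word.
by split=> H x y Eb Ey; have := H x y Eb Ey; rewrite E.
Qed.

(** * Increasing subsequences and planar matchings *)

Lemma ord_enum_sorted m : sorted (fun x y : 'I_m => x < y) (enum 'I_m).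
Proof.
by have := iota_ltn_sorted 0 m; rewrite -val_enum_ord sorted_map.
Qed.

Lemma ncols_geq_increasing m (s : {perm 'I_m}) (X : {set 'I_m}) :
  {in X &, forall x y : 'I_m, x < y -> s x < s y} -> #|X| <= ncols (RSK (perm_word s)).1.
Proof.
move=> incX; pose v := [seq x <- enum 'I_m | x \in X].
have -> : #|X| = size v.
  rewrite -(card_uniqP (filter_uniq _ (enum_uniq _))); apply: eq_card => x.
  by rewrite mem_filter mem_enum andbT.
case: (posnP (size v)) => [->//|v0].
have [_ Hmin] := RSK_patience (uniq_perm_word s).
have [|||le _] := Hmin [seq (s x).+1 | x <- v]; rewrite ?size_map //.
- exact: map_subseq (filter_subseq _ _).
- rewrite sorted_map.
  apply: (@sub_in_sorted _ (mem X) (fun x y : 'I_m => x < y)); last first.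
  + by apply: sorted_filter (ord_enum_sorted m) => y x z; apply: ltn_trans.
  + exact: filter_all.
  by move=> x y xX yX lt; apply: incX.
by rewrite size_map in le.
Qed.

Lemma ncols_increasing m (s : {perm 'I_m}) :
  exists X : {set 'I_m}, #|X| = ncols (RSK (perm_word s)).1 /\
    {in X &, forall x y : 'I_m, x < y -> s x < s y}.
Proof.
have [Hex _] := RSK_patience (uniq_perm_word s).
case: (posnP (ncols (RSK (perm_word s)).1)) => [->|n0].
  by exists set0; rewrite cards0; split=> // x; rewrite inE.
have [|u [/subseqP[b _ Eu] su zu _]] := Hex (ncols (RSK (perm_word s)).1).-1.
  by rewrite /ncols in n0 *; lia.
rewrite /perm_word -map_mask in Eu; set v := mask b (enum 'I_m) in Eu.
have tr (f : 'I_m -> nat) : transitive (fun x y => f x < f y).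
  by move=> y x z; apply: ltn_trans.
have uv : uniq v by rewrite mask_uniq // enum_uniq.
have sv : sorted (fun x y : 'I_m => x < y) v.
  exact: (sorted_mask (tr val)) (ord_enum_sorted m).
have sv' : sorted (fun x y : 'I_m => (s x).+1 < (s y).+1) v.
  by move: su; rewrite Eu sorted_map.
exists [set x in v]; split.
  rewrite cardsE (card_uniqP uv); move: zu; rewrite Eu size_map => ->.
  by rewrite prednK.
move=> x y; rewrite !inE => xv yv lt.
case: (ltngtP (index x v) (index y v)) => [lti|gti|e].
- exact: (sorted_ltn_index (tr (fun z => (s z).+1)) sv' _ _ xv yv lti).
- by have := sorted_ltn_index (tr val) sv _ _ yv xv gti; rewrite ltnNge (ltnW lt).
- by rewrite -(nth_index x xv) e nth_index // ltnn in lt.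
Qed.

Lemma Lmax_ncols n r (G : mgraph n r) (s : {perm 'I_(r * n)}) :
  regular G -> slotted (mult G) s -> Lmax G = ncols (RSK (perm_word s)).1.
Proof.
move=> /regular_biregular reg slot.
have dec := slotted_block_decreasing reg slot.
have dec' := slotted_block_decreasing (biregular_tr reg) (slotted_inv slot).
apply/eqP; rewrite eqn_leq; apply/andP; split.
  apply/bigmax_leqP => S /andP[/forall_inP edge /forall_inP cross].
  (* An edge of positive multiplicity is realised by some [x]; choosing one per edge turns a planar
     matching into an increasing set of the same size. *)
  have [e|f Hf] := @fin_all_exists {e : 'I_n * 'I_n | e \in S} (fun=> 'I_(r * n))
      (fun e x => block x = (val e).1 /\ block (s x) = (val e).2).
    have := edge _ (valP e); rewrite (slotted_contraction _ _ reg slot).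
    by case/card_gt0P => x; rewrite inE => /andP[/eqP xa /eqP xb]; exists x.
  have f_inj : injective f.
    move=> e e' E; apply: val_inj; have [E1 E2] := Hf e; have [E1' E2'] := Hf e'.
    by rewrite [LHS]surjective_pairing [RHS]surjective_pairing -E1 -E2 -E1' -E2' E.
  have <- : #|f @: setT| = #|S| by rewrite card_imset // cardsT card_sig.
  apply: ncols_geq_increasing => _ _ /imsetP[e _ ->] /imsetP[e' _ ->] lt.
  have [E1 E2] := Hf e; have [E1' E2'] := Hf e'.
  have /forall_inP/(_ _ (valP e'))/implyP := cross _ (valP e).
  case: (eqVneq e e') => [E|ne]; first by rewrite E ltnn in lt.
  move=> /(_ _)/orP[|/andP[lt1 lt2]|/andP[lt1 lt2]]; first by rewrite val_eqE.
    by apply: block_lt; rewrite E2 E2'.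
  by have : f e' < f e; [apply: block_lt; rewrite E1 E1' | lia].
have [X [<- inc]] := ncols_increasing s.
pose g (x : 'I_(r * n)) := (block x, block (s x)).
(* Two members of an increasing set share neither a block of [U], where [s] decreases, nor a block
   of [V], where its inverse does. *)
have cross x y : x \in X -> y \in X -> x < y -> block x < block y /\ block (s x) < block (s y).
  move=> xX yX lt; have lts := inc _ _ xX yX lt; rewrite !ltn_neqAle.
  rewrite /= !leq_div2r ?(ltnW lt) ?(ltnW lts) // !andbT; split; apply/eqP => E.
    have Eb : block x = block y by apply: val_inj.
    by have := dec _ _ Eb lt; rewrite ltnNge (ltnW lts).
  have Eb : block (s x) = block (s y) by apply: val_inj.
  by have := dec' _ _ Eb lts; rewrite !permK ltnNge (ltnW lt).
have g_inj : {in X &, injective g}.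
  move=> x y xX yX [E1 _]; case: (ltngtP x y) => [lt|gt|/val_inj //].
    by have [] := cross _ _ xX yX lt; rewrite /= E1 ltnn.
  by have [] := cross _ _ yX xX gt; rewrite /= E1 ltnn.
rewrite -(card_in_imset g_inj); apply: leq_bigmax_cond.
apply/andP; split; apply/forall_inP => _ /imsetP[x xX ->].
  rewrite (slotted_contraction _ _ reg slot); apply/card_gt0P; exists x.
  by rewrite inE !eqxx.
apply/forall_inP => _ /imsetP[y yX ->]; apply/implyP => ne; rewrite /noncrossing.
case: (ltngtP x y) => [lt|gt|/val_inj E]; last by rewrite E eqxx in ne.
  by have [-> ->] := cross _ _ xX yX lt.
by have [-> ->] := cross _ _ yX xX gt; rewrite orbT.
Qed.

(** * The image of the configurations and the count *)

Lemma in_GbarP n r d (s : {perm 'I_(r * n)}) :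
  in_Gbar d s <-> [/\ block_decreasing s, block_decreasing s^-1%g
                    & ncols (RSK (perm_word s)).1 <= d].
Proof.
split=> [[G []] | [dec dec' led]].
  rewrite inE => /andP[reg leL] /(is_conf_of_slotted _ reg) slot.
  have breg := regular_biregular reg; rewrite -(Lmax_ncols reg slot); split=> //.
    exact: slotted_block_decreasing slot.
  exact: slotted_block_decreasing (biregular_tr breg) (slotted_inv slot).
(* [inord] does not truncate here: each multiplicity is at most a row sum, which is [r]. *)
pose G : mgraph n r := [ffun e => inord (contraction s e.1 e.2)].
have [row col] := contraction_biregular s.
have GE a b : mult G a b = contraction s a b.
  rewrite /mult ffunE /= inordK // ltnS.
  by apply: (@leq_trans (\sum_b' contraction s a b')); [rewrite (bigD1 b) ?leq_addr | rewrite row].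
have reg : regular G.
  by apply/andP; split; apply/forallP => a; apply/eqP;
     under eq_bigr do rewrite GE; [apply: row | apply: col].
have slot : slotted (mult G) s.
  move=> x; have [a [b [c [ltc Ex Ey]]]] := block_decreasing_slotted dec dec' x.
  exists a, b, c; rewrite GE; split=> //.
    by rewrite Ex; congr (_ + (_ + _)); apply: eq_bigr => b' _; rewrite GE.
  by rewrite Ey; congr (_ + (_ + _)); apply: eq_bigr => a' _; rewrite GE.
exists G; split; last by apply/is_conf_of_slotted.
by rewrite inE reg (Lmax_ncols reg slot).
Qed.

Lemma Gbar_good_pair n r d (s : {perm 'I_(r * n)}) :
  in_Gbar d s <-> good_pair n r d (RSK (perm_word s)).
Proof.
apply: (iff_trans (in_GbarP d s)).
have [tP pP sh SQ] := RSK_tableaux (uniq_perm_word s).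
rewrite size_perm_word in SQ.
have SP : SYT (r * n) (RSK (perm_word s)).1.
  by rewrite SYTE tP (perm_trans pP (perm_perm_word s)).
have Ec : ncols (RSK (perm_word s)).2 = ncols (RSK (perm_word s)).1.
  by case: (RSK (perm_word s)) sh => [[|? ?] [|? ?]] //= [].
split=> [[/condT_recording cQ /condT_insertion cP led]|[_ /andP[_ led] _]].
  by split=> //; rewrite /in_T ?Ec ?SP ?SQ.
by move=> /condT_insertion cP /condT_recording cQ.
Qed.

Lemma good_pair_RSK n r d PQ : good_pair n r d PQ ->
  exists s : {perm 'I_(r * n)}, RSK (perm_word s) = PQ.
Proof.
case: PQ => P Q [/= sh /andP[SP _] /andP[SQ _] _ _].
have := SP; rewrite SYTE => /andP[tP pP].
have uP : uniq (flatten P) by rewrite (perm_uniq pP) iota_uniq.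
have [w [pw Ew]] := RSK_surj tP uP SQ sh.
by have [s Es] := perm_word_surj (perm_trans pw pP); exists s; rewrite Es.
Qed.

Lemma RSK_perm_word_inj m (s1 s2 : {perm 'I_m}) :
  RSK (perm_word s1) = RSK (perm_word s2) -> s1 = s2.
Proof.
move=> E; apply: perm_word_inj; apply: RSK_inj E; rewrite ?uniq_perm_word //.
by rewrite !size_perm_word.
Qed.

(** [in_Gbar] is a proposition, so the finite set is built as the image of [Gset] under a chosen
    configuration map, which is injective because contraction recovers the multigraph. *)
Lemma card_Gbar n r d :
  exists S : {set {perm 'I_(r * n)}},
    #|S| = gcount n r d /\ forall s, in_Gbar d s <-> s \in S.
Proof.
have [G|conf Hconf] := @fin_all_exists _ (fun=> {perm 'I_(r * n)})
    (fun G s => G \in Gset n r d -> slotted (mult G) s).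
  (* Outside [Gset] the value is arbitrary; the identity serves as a default. *)
  have [|nG] := boolP (G \in Gset n r d); last by exists 1%g.
  rewrite inE => /andP[/regular_biregular reg _].
  by have [s slot] := slotted_exists reg; exists s.
have regG G : G \in Gset n r d -> regular G by rewrite inE => /andP[].
exists (conf @: Gset n r d); split.
  apply: card_in_imset => G G' GG GG' E; apply/ffunP => -[a b]; apply: val_inj.
  have slot := Hconf _ GG; have slot' := Hconf _ GG'; rewrite -E in slot'.
  have reg := regular_biregular (regG _ GG); have reg' := regular_biregular (regG _ GG').
  have := slotted_contraction a b reg' slot'.
  by rewrite -(slotted_contraction a b reg slot).
move=> s; split=> [[G [GG]]|/imsetP[G GG ->]].
  move/(is_conf_of_slotted _ (regG _ GG)) => slot; apply/imsetP; exists G => //.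
  exact: slotted_uniq (regular_biregular (regG _ GG)) slot (Hconf _ GG).
by exists G; split=> //; apply/is_conf_of_slotted; [apply: regG | apply: Hconf].
Qed.

Theorem theorem5 (n r d : nat) (hn : 0 < n) (hr : 0 < r) :
  (* injective on \overline G_r(U,V;d) *)
  (forall s1 s2 : {perm 'I_(r * n)}, in_Gbar d s1 -> in_Gbar d s2 ->
     RSK (perm_word s1) = RSK (perm_word s2) -> s1 = s2) /\
  (* image is exactly the set of good pairs *)
  (forall PQ : tableau * tableau,
     (exists s : {perm 'I_(r * n)}, in_Gbar d s /\ RSK (perm_word s) = PQ)
     <-> good_pair n r d PQ) /\
  (* g(n;d) equals the number of such pairs *)
  (exists l : seq (tableau * tableau),
     [/\ uniq l, (forall PQ, PQ \in l <-> good_pair n r d PQ)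
       & size l = gcount n r d]).
Proof.
have image PQ : (exists s : {perm 'I_(r * n)}, in_Gbar d s /\ RSK (perm_word s) = PQ)
     <-> good_pair n r d PQ.
  split=> [[s [/Gbar_good_pair gp <-]] // | gp].
  by have [s Es] := good_pair_RSK gp; exists s; split=> //; apply/Gbar_good_pair; rewrite Es.
split; first by move=> s1 s2 _ _; apply: RSK_perm_word_inj.
split=> //; have [S [cardS memS]] := card_Gbar n r d.
exists [seq RSK (perm_word s) | s <- enum S]; split.
- by rewrite map_inj_uniq ?enum_uniq // => s1 s2; apply: RSK_perm_word_inj.
- move=> PQ; rewrite -image; split=> [/mapP[s]|[s [/memS sS <-]]].
    by rewrite mem_enum => /memS sG ->; exists s.
  by apply/mapP; exists s; rewrite ?mem_enum.
- by rewrite size_map -cardE.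
Qed.
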